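(* Let $s\in(0,1)$, $\varepsilon\in(0,1)$, $\beta\in(\max(2s,1),2)$ and $h\in C^\beta(\mathbb R^n)$. Let $L$ be the symmetric $2s$-stable process and $L^\varepsilon$ its truncation obtained by removing jumps of size at most $\varepsilon$, as defined in the context. Then there is a constant $C_1$ (independent of $\varepsilon$, $h$, $t$, $t'$) such that for all $0\le t'\le t\le T$, $$\big|\mathbf E\big[h(L_{t-t'})-h(L^\varepsilon_{t-t'})\big]\big|\le C_1\,\varepsilon^{\beta-2s}\,|h|_\beta\,(t-t').$$
   Context: $T>0$ and $n\ge3$. On a complete filtered probability space satisfying the usual conditions, $N(\mathrm d\eta,\mathrm d\mathrm y)$ is a Poisson random measure on $[0,T]\times(\mathbb R^n\setminus\{0\})$ with intensity $\nu(\mathrm d\mathrm y)\,\mathrm d\eta$, where $\nu(\mathrm d\mathrm y)=C(n,s)|\mathrm y|^{-n-2s}\mathrm d\mathrm y$, $C(n,s)=\frac{s2^{2s}\Gamma(\frac n2+s)}{\pi^{n/2}\Gamma(1-s)}$, and $\widetilde N=N-\nu(\mathrm d\mathrm y)\mathrm d\eta$ is the compensated measure. Define $$L_t=\int_0^t\int_{|\mathrm y|<1}\mathrm y\,\widetilde N(\mathrm d\eta,\mathrm d\mathrm y)+\int_0^t\int_{|\mathrm y|\ge1}\mathrm y\,N(\mathrm d\eta,\mathrm d\mathrm y),\qquad L^\varepsilon_t=\int_0^t\int_{\varepsilon<|\mathrm y|<1}\mathrm y\,\widetilde N(\mathrm d\eta,\mathrm d\mathrm y)+\int_0^t\int_{|\mathrm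 y|\ge1}\mathrm y\,N(\mathrm d\eta,\mathrm d\mathrm y).$$ For $\beta=\lfloor\beta\rfloor+\{\beta\}^+>0$ with $\{\beta\}^+\in[0,1)$, $C^\beta(\mathbb R^n)$ is the space of functions $h$ on $\mathbb R^n$ with finite norm $$|h|_\beta=\sum_{|\gamma|\le\lfloor\beta\rfloor}\sup_{\mathrm x}|\partial^\gamma h(\mathrm x)|+\sup_{|\gamma|=\lfloor\beta\rfloor,\;\mathrm x,\mathrm h'\ne0}\frac{|\partial^\gamma h(\mathrm x+\mathrm h')-\partial^\gamma h(\mathrm x)|}{|\mathrm h'|^{\{\beta\}^+}}.$$ *)

(* Defs.v *)
From HB Require Import structures.
From mathcomp Require Import all_boot all_order all_algebra.
From mathcomp Require Import all_classical all_reals all_analysis.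
From mathcomp Require Import measurable_realfun.
Set Implicit Arguments.
Unset Strict Implicit.
Unset Printing Implicit Defensive.
Import Order.TTheory GRing.Theory Num.Theory.
Import numFieldNormedType.Exports.
Import HBSimple.
Local Open Scope classical_set_scope.
Local Open Scope ring_scope.

(* The Borel sigma-algebra of R^n, generated by the coordinate functions as in
   the library's structure on [n.-tuple T]. *)
Definition rV_display : measure_display.
Proof. exact: default_measure_display. Qed.

Section measurable_rV.
Context {R : realType} (n : nat).

Let coors : 'I_n -> 'rV[R]_n -> R := fun i x => x ord0 i.

Let rV_set0 : g_sigma_preimage coors set0.
Proof. exact: sigma_algebra0. Qed.

Let rV_setC A : g_sigma_preimage coors A -> g_sigma_preimage coors (~` A).
Proof. exact: sigma_algebraC. Qed.

Let rV_bigcup (F : _^nat) : (forall i, g_sigma_preimage coors (F i)) ->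
  g_sigma_preimage coors (\bigcup_i (F i)).
Proof. exact: sigma_algebra_bigcup. Qed.

HB.instance Definition _ := @isMeasurable.Build rV_display
  'rV[R]_n (g_sigma_preimage coors) rV_set0 rV_setC rV_bigcup.

End measurable_rV.

Lemma measurable_coord (R : realType) n (i : 'I_n) :
  measurable_fun [set: 'rV[R]_n] (fun x : 'rV[R]_n => x ord0 i).
Proof.
move=> _ Y mY; rewrite setTI; apply: sub_sigma_algebra => /=.
rewrite -bigcup_seq/=; exists i => /=; first by rewrite mem_index_enum.
by exists Y => //; rewrite setTI.
Qed.

Lemma measurable_fun_coordP d (T : measurableType d) (R : realType) n
    (f : T -> 'rV[R]_n) :
  (forall i, measurable_fun [set: T] (fun x => f x ord0 i)) ->
  measurable_fun [set: T] f.
Proof.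
move=> mf _ Y mY; rewrite setTI; move: Y mY.
apply: smallest_sub.
  split=> /=.
  - by rewrite preimage_set0.
  - by move=> A mA; rewrite setTD preimage_setC; exact: measurableC.
  - by move=> A mA; rewrite preimage_bigcup; exact: bigcup_measurable.
move=> Y; rewrite -bigcup_seq => -[i _ [B mB <-]].
rewrite setTI /=; have := mf i measurableT B mB; rewrite setTI; exact.
Qed.

Section lebesgue_rV.
Context {R : realType}.
Local Open Scope ereal_scope.

Definition rV_cons n (p : measurableTypeR R * 'rV[R]_n) : 'rV[R]_n.+1 :=
  \row_i oapp (p.2 ord0) p.1 (unlift ord0 i).

Definition rV_uncons n (x : 'rV[R]_n.+1) : measurableTypeR R * 'rV[R]_n :=
  (x ord0 ord0, \row_i x ord0 (lift ord0 i)).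

Lemma rV_consK n : cancel (@rV_cons n) (@rV_uncons n).
Proof.
case=> a v; rewrite /rV_cons /rV_uncons/= mxE unlift_none/=; congr pair.
by apply/rowP => i; rewrite !mxE liftK.
Qed.

Lemma rV_unconsK n : cancel (@rV_uncons n) (@rV_cons n).
Proof.
move=> x; apply/rowP => i; rewrite !mxE/=.
by case: unliftP => [j|] ->//=; rewrite mxE.
Qed.

Lemma measurable_rV_cons n : measurable_fun setT (@rV_cons n).
Proof.
apply: measurable_fun_coordP => i.
case: (unliftP ord0 i) => [j|] ->.
  under eq_fun do rewrite mxE liftK/=.
  apply: (measurableT_comp (@measurable_coord R n j)).
  exact: measurable_snd.
under eq_fun do rewrite mxE unlift_none/=.
exact: measurable_fst.
Qed.

Lemma measurable_rV_uncons n : measurable_fun setT (@rV_uncons n).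
Proof.
apply: measurable_fun_pair => /=; first exact: measurable_coord.
apply: measurable_fun_coordP => i.
rewrite [X in measurable_fun _ X](_ : _ =
  fun x : 'rV[R]_n.+1 => x ord0 (lift ord0 i)); first exact: measurable_coord.
by apply/funext => x /=; rewrite mxE.
Qed.

Section step.
Context n (m : {sigma_finite_measure set 'rV[R]_n -> \bar R}).

Definition lebesgue_rVS : set 'rV[R]_n.+1 -> \bar R :=
  pushforward (lebesgue_measure \x m) (@rV_cons n).

Let mu0 : lebesgue_rVS set0 = 0.
Proof. by rewrite /lebesgue_rVS /pushforward preimage_set0 measure0. Qed.

Let mu_ge0 A : 0 <= lebesgue_rVS A.
Proof. exact: (measure_ge0 (lebesgue_measure \x m)). Qed.

Let mpre A : measurable A -> measurable (@rV_cons n @^-1` A).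
Proof.
by move=> mA; rewrite -[X in measurable X]setTI; exact: measurable_rV_cons.
Qed.

Let mu_sigma_additive : semi_sigma_additive lebesgue_rVS.
Proof.
move=> F mF tF mUF; rewrite /lebesgue_rVS /pushforward preimage_bigcup.
apply: measure_semi_sigma_additive.
- by move=> k; exact: mpre.
- apply/trivIsetP => /= i j _ _ ij; rewrite -preimage_setI.
  by move/trivIsetP : tF => /(_ _ _ _ _ ij) ->//; rewrite preimage_set0.
- by rewrite -preimage_bigcup; exact: mpre.
Qed.

HB.instance Definition _ := isMeasure.Build _ _ _ lebesgue_rVS
  mu0 mu_ge0 mu_sigma_additive.

Let mu_sigma_finite : sigma_finite setT lebesgue_rVS.
Proof.
have /sigma_finiteP[F [TF ndF Foo]] := sigma_finiteT (@lebesgue_measure R).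
have /sigma_finiteP[G [TG ndG Goo]] := sigma_finiteT m.
exists (fun k => @rV_uncons n @^-1` (F k `*` G k)).
  apply/esym; rewrite -subTset => x _.
  have [i _ Fi] : (\bigcup_i F i) (rV_uncons x).1 by rewrite -TF.
  have [j _ Gj] : (\bigcup_i G i) (rV_uncons x).2 by rewrite -TG.
  exists (maxn i j) => //; split.
    by move: Fi; exact/subsetPset/ndF/leq_maxl.
  by move: Gj; exact/subsetPset/ndG/leq_maxr.
move=> k; have [mFk Fk] := Foo k; have [mGk Gk] := Goo k; split.
  rewrite -[X in measurable X]setTI; apply: measurable_rV_uncons => //.
  exact: measurableX.
rewrite /lebesgue_rVS /pushforward -comp_preimage.
rewrite (_ : _ \o _ = id); last by apply/funext => x /=; rewrite rV_consK.
by rewrite preimage_id product_measure1E// lte_mul_pinfty// ge0_fin_numE.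
Qed.

HB.instance Definition _ := @Measure_isSigmaFinite.Build _ _ _ lebesgue_rVS
  mu_sigma_finite.

End step.

(* R^0 is a point and R^n.+1 is identified with R x R^n by [rV_cons]. *)
Fixpoint lebesgue_rV n : {sigma_finite_measure set 'rV[R]_n -> \bar R} :=
  match n with
  | 0 => dirac (0%R : 'rV[R]_0)
  | n'.+1 => lebesgue_rVS (lebesgue_rV n')
  end.

End lebesgue_rV.

Section euclidean.
Context {R : realType} {n : nat}.

(* The library norm of ['rV[R]_n] is the sup norm. *)
Definition enorm (x : 'rV[R]_n) : R := Num.sqrt (\sum_i x ord0 i ^+ 2).

Lemma measurable_enorm : measurable_fun setT enorm.
Proof.
apply: (@measurableT_comp _ _ _ _ _ _ (@Num.sqrt R)).
  by apply: continuous_measurable_fun; exact: sqrt_continuous.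
apply: measurable_sum => i; apply: measurable_funX; exact: measurable_coord.
Qed.

End euclidean.

Section stable_levy_measure.
Context {R : realType}.

Definition Gamma (x : R) : R :=
  \int[lebesgue_measure]_(u in `]0, +oo[) (u `^ (x - 1) * expR (- u)).

Definition stable_cst (n : nat) (s : R) : R :=
  s * 2 `^ (2 * s) * Gamma (n%:R / 2 + s) / (pi `^ (n%:R / 2) * Gamma (1 - s)).

Lemma Gamma_ge0 x : 0 <= Gamma x.
Proof.
apply: Rintegral_ge0 => u _.
by rewrite mulr_ge0 ?powR_ge0 ?expR_ge0.
Qed.

Lemma stable_cst_ge0 n s : 0 < s -> 0 <= stable_cst n s.
Proof.
move=> s0; rewrite /stable_cst.
by rewrite !(mulr_ge0, invr_ge0)// ?powR_ge0 ?Gamma_ge0// ltW.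
Qed.

Definition stable_density (n : nat) (s : R) (y : 'rV[R]_n) : R :=
  stable_cst n s * enorm y `^ (- n%:R - 2 * s).

Section measure.
Context (n : nat) (s : R) (s_gt0 : 0 < s).
Local Open Scope ereal_scope.

(* [s_gt0] makes the density nonnegative; as in [mrestr], it is an argument
   so that the measure instance can be inferred. *)
Definition stable_nu (_ : (0 < s)%R) : set 'rV[R]_n -> \bar R := fun A =>
  \int[lebesgue_rV n]_(y in A `&` [set y | y != 0%R]) (stable_density s y)%:E.

Local Notation nu := (stable_nu s_gt0).

Let density_ge0 y : 0 <= (@stable_density n s y)%:E.
Proof. by rewrite lee_fin mulr_ge0 ?powR_ge0// stable_cst_ge0. Qed.

Let measurable_density : measurable_fun setT (EFin \o @stable_density n s).
Proof.
apply/measurable_EFinP; apply: measurable_funM => //.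
apply: (measurableT_comp (measurable_powR _)).
exact: measurable_enorm.
Qed.

Let measurable_neq0 : measurable [set y : 'rV[R]_n | y != 0%R].
Proof.
rewrite (_ : [set _ | _] = enorm @^-1` (~` [set 0%R])).
  rewrite -[X in measurable X]setTI; apply: measurable_enorm => //.
  exact: measurableC.
apply/seteqP; split=> y /=; last first.
  move=> y0; apply: contra_notN y0 => /eqP ->; rewrite /enorm big1 ?sqrtr0//.
  by move=> i _; rewrite mxE expr0n.
move=> /eqP y0 e0; apply: y0; apply/rowP => i; rewrite mxE.
move/eqP : e0; rewrite sqrtr_eq0 => e0.
have /eqP := le_anti (introT andP
  (conj e0 (sumr_ge0 _ (fun j _ => sqr_ge0 (y ord0 j))))).
rewrite psumr_eq0 => [/allP/(_ i)|j _]; last exact: sqr_ge0.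
by rewrite mem_index_enum => /(_ isT); rewrite sqrf_eq0 => /eqP.
Qed.

Let nu0 : nu set0 = 0.
Proof. by rewrite /stable_nu set0I integral_set0. Qed.

Let nu_ge0 A : 0 <= nu A.
Proof. by apply: integral_ge0 => y _; exact: density_ge0. Qed.

Let nu_sigma_additive : semi_sigma_additive nu.
Proof.
move=> F mF tF mUF; rewrite /stable_nu setI_bigcupl.
apply: semi_sigma_additive_nng_induced => //.
- by move=> k; exact: measurableI.
- exact: trivIset_setIr.
- by apply: bigcup_measurable => k _; exact: measurableI.
Qed.

HB.instance Definition _ := isMeasure.Build _ _ _ nu
  nu0 nu_ge0 nu_sigma_additive.

Let nu_sigma_finite : sigma_finite setT nu.
Proof.
have [F UF mF] := sigma_finiteT (@lebesgue_rV R n).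
pose G (k : nat) := (@stable_density n s) @^-1` `]-oo, k%:R].
have mG k : measurable (G k).
  rewrite -[X in measurable X]setTI.
  by move/measurable_EFinP : measurable_density; apply.
pose H (p : nat * nat) := F p.1 `&` G p.2.
exists (fun k =>
  if (unpickle k : option (nat * nat)) is Some p then H p else set0).
  apply/esym; rewrite -subTset => y _.
  have : (\bigcup_i F i) y by rewrite -UF.
  move=> [i _ Fy].
  exists (pickle (i, (Num.truncn (@stable_density n s y)).+1)) => //.
  by rewrite /= pickleK; split => //=; rewrite /G/= in_itv/= ltW// truncnS_gt.
move=> k; case: unpickle => [[i j]|]; last by rewrite measure0.
have [mFi Fi] := mF i; split; first exact: measurableI.
rewrite /stable_nu.
apply: (@le_lt_trans _ _
  (\int[lebesgue_rV n]_(y in H (i, j) `&` [set y | y != 0%R]) (j%:R)%:E)).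
  apply: ge0_le_integral => //.
  - by apply: measurableI => //; exact: measurableI.
  - exact: measurable_funTS.
  - by move=> y [[_ Gy] _]; move: Gy; rewrite /G/= in_itv/= lee_fin.
have mH : measurable (H (i, j) `&` [set y | y != 0%R]).
  by apply: measurableI => //; exact: measurableI.
rewrite integral_cst//.
apply: lte_mul_pinfty => //.
apply: le_lt_trans Fi; apply: le_measure; rewrite ?inE//.
by move=> y [[]].
Qed.

HB.instance Definition _ := @Measure_isSigmaFinite.Build _ _ _ nu
  nu_sigma_finite.

End measure.

(* The intensity nu(dy) d(eta) on [0, T] x (R^n \ {0}), seen as a measure on
   R x R^n that vanishes outside this set. *)
Definition stable_intensity (n : nat) (s : R) (s_gt0 : 0 < s) (T : R) :
    {measure set (measurableTypeR R * 'rV[R]_n) -> \bar R} :=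
  product_measure1 (mrestr lebesgue_measure (measurable_itv `[0, T]))
    (@stable_nu n s s_gt0).

End stable_levy_measure.

Section random_measure.
Context {R : realType} d (Omega : measurableType d) (P : probability Omega R).
Local Open Scope ereal_scope.

Definition usual_conditions (T : R) (F : R -> set (set Omega)) :=
  [/\ measure_is_complete P,
      forall t, (0 <= t <= T)%R ->
        sigma_algebra setT (F t) /\ F t `<=` measurable,
      forall t u, (0 <= t)%R -> (t <= u)%R -> (u <= T)%R -> F t `<=` F u,
      forall t, (0 <= t < T)%R -> \bigcap_(u in `]t, T]) F u `<=` F t &
      P.-negligible `<=` F 0%R].

Context d' (E : measurableType d') (N : R.-ker Omega ~> E)
  (mu : {measure set E -> \bar R}).

(* [poisson_prob r k] does not depend on [k]; unlike [poisson_pmf], it is the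
   Dirac mass at 0 when [r = 0]. *)
Definition poisson_random_measure :=
  [/\ forall w A, measurable A ->
        N w A = +oo \/ exists k : nat, N w A = k%:R%:E,
      forall A, measurable A -> mu A < +oo -> forall k : nat,
        P [set w | N w A = k%:R%:E] = poisson_prob (fine (mu A)) 0 [set k],
      forall A, measurable A -> mu A = +oo -> {ae P, forall w, N w A = +oo} &
      forall m (A : 'I_m -> set E), (forall i, measurable (A i)) ->
        trivIset setT A ->
        forall B : 'I_m -> set (\bar R), (forall i, measurable (B i)) ->
        P (\bigcap_i (N ^~ (A i) @^-1` B i)) =
        \prod_(i < m) P (N ^~ (A i) @^-1` B i)].

(* X is (a version of) the integral over D of f against the compensated
   measure N - mu: the L^2(mu)-to-L^2(P) extension of the pathwise
   difference of integrals of simple functions. *)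
Definition compensated_integral (D : set E) (f : E -> R) (X : Omega -> R) :=
  measurable_fun setT X /\
  exists g : nat -> {sfun E >-> R},
  [/\ forall k, mu.-integrable D (EFin \o g k),
      \int[mu]_(z in D) ((g k z - f z) ^+ 2)%:E @[k --> \oo] --> 0 &
      \int[P]_w ((X w -
        (\int[N w]_(z in D) g k z - \int[mu]_(z in D) g k z)) ^+ 2)%:E
        @[k --> \oo] --> 0].

End random_measure.

Section levy_process.
Context {R : realType} {n : nat} d (Omega : measurableType d).
Context (P : probability Omega R).
Context (N : R.-ker Omega ~> (measurableTypeR R * 'rV[R]_n)%type).
Context (mu : {measure set (measurableTypeR R * 'rV[R]_n) -> \bar R}).

(* For t in [0, T], L t is a.s. the sum of the integral of y against N - mu
   over ]0, t] x B and of the integral of y against N over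
   ]0, t] x {|y| >= 1}. *)
Definition levy_ito_process (T : R) (B : set 'rV[R]_n)
    (L : R -> Omega -> 'rV[R]_n) :=
  forall t, 0 <= t <= T -> measurable_fun setT (L t) /\
  exists2 M : Omega -> 'rV[R]_n,
    forall i : 'I_n, compensated_integral P N mu
      (`]0, t] `*` B) (fun z => z.2 ord0 i) (fun w => M w ord0 i) &
    {ae P, forall w, L t w = M w + \row_(i < n)
      \int[N w]_(z in `]0%R, t] `*` [set y | 1 <= enorm y]) z.2 ord0 i}.

End levy_process.

Section stable_process.
Context {R : realType} {n : nat} d (Omega : measurableType d).
Context (P : probability Omega R).
Context (N : R.-ker Omega ~> (measurableTypeR R * 'rV[R]_n)%type).
Context (s : R) (s_gt0 : 0 < s) (T : R).

Definition stable_process (L : R -> Omega -> 'rV[R]_n) :=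
  levy_ito_process P N (stable_intensity n s_gt0 T) T
    [set y | y != 0 /\ enorm y < 1] L.

Definition truncated_stable_process (eps : R) (L : R -> Omega -> 'rV[R]_n) :=
  levy_ito_process P N (stable_intensity n s_gt0 T) T
    [set y | eps < enorm y < 1] L.

End stable_process.

Section holder.
Context {R : realType} {n : nat}.
Implicit Types (h : 'rV[R]_n -> R) (beta : R).

Definition partial (i : 'I_n) h : 'rV[R]_n -> R :=
  fun x => 'D_(delta_mx ord0 i) h x.

Definition multi_partial k (g : {ffun 'I_n -> 'I_k}) h : 'rV[R]_n -> R :=
  foldr (fun i f => iter (g i) (partial i) f) h (enum 'I_n).

(* All iterated partial derivatives of h up to order k exist. *)
Definition has_partials (k : nat) h := forall l : seq 'I_n, (size l < k)%N ->
  forall i x, derivable (foldr partial h l) x (delta_mx ord0 i).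

Definition sup_norm h : \bar R :=
  ereal_sup [set `|h x|%:E | x in [set: 'rV[R]_n]].

(* A multi-index of order at most k is a function ['I_n -> 'I_k.+1]. *)
Definition holder_seminorm beta h : \bar R :=
  let k := Num.truncn beta in
  ereal_sup [set r | exists (g : {ffun 'I_n -> 'I_k.+1}) (x y : 'rV[R]_n),
    [/\ (\sum_i g i)%N = k, y != 0 &
     r = (`|multi_partial g h (x + y) - multi_partial g h x| /
          enorm y `^ (beta - k%:R))%:E]].

Definition holder_norm beta h : \bar R :=
  let k := Num.truncn beta in
  (\sum_(g : {ffun 'I_n -> 'I_k.+1} | (\sum_i g i <= k)%N)
     sup_norm (multi_partial g h) + holder_seminorm beta h)%E.

Definition holder_space beta : set ('rV[R]_n -> R) :=
  [set h | has_partials (Num.truncn beta) h /\ (holder_norm beta h < +oo)%E].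

End holder.

(* Main.v *)
Require Import Defs.
From HB Require Import structures.
From mathcomp Require Import all_boot all_order all_algebra.
From mathcomp Require Import all_classical all_reals all_analysis.
From mathcomp Require Import measurable_realfun ring lra.
Set Implicit Arguments.
Unset Strict Implicit.
Unset Printing Implicit Defensive.
Import Order.TTheory GRing.Theory Num.Theory.
Import numFieldNormedType.Exports.
Import HBSimple.
Local Open Scope classical_set_scope.
Local Open Scope ring_scope.

(** Idea: [L_t - L^eps_t] is the compensated integral [Z] of the jumps of size at
    most [eps], and it is independent of [L^eps_t].  Approximate the integrand [y]
    in L^2 by simple functions; then [Z] becomes a finite sum
    [sum_j (N(A_j) - mu(A_j)) y_j] over disjoint sets [A_j], whose terms can be
    added to [L^eps_t] one at a time.  Each new term is centered and independent of
    the terms already added, so the first-order part of the Taylor expansion of [h]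
    has expectation zero, and the remainder is at most a constant times
    [|h|_beta |y_j|^beta E|N(A_j) - mu(A_j)|^beta].  As [1 <= beta <= 2], the last
    factor is bounded by variance plus first moment, hence by [3 mu(A_j)]: it is
    linear in [mu(A_j)].  Summing over [j] gives [3 t] times the integral of
    [|y|^beta] over [0 < |y| <= eps] against [nu], which is of order
    [eps^(beta - 2s)]. *)

(** * Independence for Poisson random measures *)

(** The processes are given only as versions: [compensated_integral] supplies, for each coordinate,
    some approximating sequence, possibly different for [L] and for [Leps]. The isometry shows that
    every sequence of simple functions with the right L^2 limit serves as well, so both integrands
    are replaced by the same simple functions. For these the integral over all jumps smaller than 1
    splits almost surely into a kept and a removed part, and the kept part is a function of [N]
    outside the removed region; the independence used for [Leps] is obtained at this level only.
    Being dominated by [y] in each coordinate, the simple functions make the sum of |y_j|^beta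
    mu(A_j) at most the integral of |y|^beta at once, with no passage to the limit there; the limit
    concerns only L^2 errors, which turn into errors of expectations because [h] is Lipschitz. On
    the side of [h] only partial derivatives are at hand, so the Taylor estimate moves parallel to
    the axes, one coordinate at a time. *)

Section independence.
Context {R : realType} d (Omega : measurableType d) (P : probability Omega R).
Local Open Scope ereal_scope.

(** The hypothesis on rectangles identifies the joint law of [(X1, X2)] with the product of the two
    laws; Tonelli then separates the integral. *)
Lemma ge0_integral_indep d1 d2 (T1 : measurableType d1) (T2 : measurableType d2)
    (X1 : Omega -> T1) (X2 : Omega -> T2) (f1 : T1 -> \bar R)
    (f2 : T2 -> \bar R) :
  measurable_fun setT X1 -> measurable_fun setT X2 ->
  (forall A B, measurable A -> measurable B ->
    P (X1 @^-1` A `&` X2 @^-1` B) = P (X1 @^-1` A) * P (X2 @^-1` B)) ->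
  measurable_fun setT f1 -> measurable_fun setT f2 ->
  (forall x, 0 <= f1 x) -> (forall x, 0 <= f2 x) ->
  \int[P]_w (f1 (X1 w) * f2 (X2 w)) =
  \int[P]_w f1 (X1 w) * \int[P]_w f2 (X2 w).
Proof.
move=> mX1 mX2 X12 mf1 mf2 f1_ge0 f2_ge0.
pose X1' : {mfun Omega >-> T1} := mfun_Sub (mem_set mX1).
pose X2' : {mfun Omega >-> T2} := mfun_Sub (mem_set mX2).
have mX : measurable_fun setT (fun w => (X1 w, X2 w)).
  exact: measurable_fun_pair.
pose X' : {mfun Omega >-> (T1 * T2)%type} := mfun_Sub (mem_set mX).
pose f := fun x : T1 * T2 => f1 x.1 * f2 x.2.
have f_ge0 x : 0 <= f x by rewrite mule_ge0.
have mf : measurable_fun setT f.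
  apply: emeasurable_funM.
    by apply: (measurableT_comp mf1); exact: measurable_fst.
  by apply: (measurableT_comp mf2); exact: measurable_snd.
transitivity (\int[distribution P X']_x f x).
  by rewrite ge0_integral_distribution// => x; exact: f_ge0.
transitivity (\int[distribution P X1' \x distribution P X2']_x f x).
  apply: eq_measure_integral => A mA _; apply/esym.
  apply: product_measure_unique => //=.
rewrite fubini_tonelli1// /fubini_F.
under eq_integral => x _.
  rewrite /f/= ge0_integralZl//.
  rewrite ge0_integral_distribution//.
  over.
rewrite ge0_integralZr//; last by apply: integral_ge0 => x _ /=.
by rewrite ge0_integral_distribution.
Qed.

End independence.

Section poisson_random_measure.
Context {R : realType} d (Omega : measurableType d) (P : probability Omega R).
Context d' (E : measurableType d') (N : R.-ker Omega ~> E)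
  (mu : {measure set E -> \bar R}).
Hypothesis pN : poisson_random_measure P N mu.
Local Open Scope ereal_scope.

Let measurable_N (A : set E) : measurable A ->
  measurable_fun setT (fun w => N w A).
Proof. exact: measurable_kernel. Qed.

Let measurable_preN (A : set E) (V : set (\bar R)) :
  measurable A -> measurable V -> measurable (N ^~ A @^-1` V).
Proof. by move=> mA mV; rewrite -[X in measurable X]setTI; exact: measurable_N. Qed.

(** Reindexing of the product formula by an arbitrary finite type; it is applied below to sets
    indexed by [option {set 'I_m}]. *)
Lemma prm_indep_fin (J : finType) (A : J -> set E) (B : J -> set (\bar R)) :
  (forall i, measurable (A i)) -> trivIset setT A ->
  (forall i, measurable (B i)) ->
  P (\bigcap_i (N ^~ (A i) @^-1` B i)) = \prod_i P (N ^~ (A i) @^-1` B i).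
Proof.
move=> mA tA mB; have [_ _ _ indep] := pN.
pose A' (j : 'I_#|J|) := A (enum_val j).
pose B' (j : 'I_#|J|) := B (enum_val j).
rewrite [LHS](_ : _ = P (\bigcap_j (N ^~ (A' j) @^-1` B' j))); last first.
  congr (P _); apply/seteqP; split=> w h j _; first exact: h.
  by have := h (enum_rank j) I; rewrite /A' /B' /= enum_rankK.
have tA' : trivIset setT A'.
  by move=> i j _ _ /(tA _ _ I I) /enum_val_inj.
rewrite (indep _ A' (fun j => mA (enum_val j)) tA' B' (fun j => mB (enum_val j))).
by rewrite [RHS](reindex (@enum_val J predT))//; exact/onW_bij/enum_val_bij.
Qed.

(** A generating class for the sigma-algebra of [N] restricted to [C]. The sets [A i] may overlap:
    this makes the class closed under intersection, at the price of a reduction to disjoint sets in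
    the proof of independence. *)
Definition prm_cylinders (C : set E) : set (set Omega) :=
  [set G | exists m (A : 'I_m -> set E) (B : 'I_m -> set (\bar R)),
    [/\ forall i, measurable (A i), forall i, A i `<=` C,
        forall i, measurable (B i) &
        G = \bigcap_i (N ^~ (A i) @^-1` B i)]].

Lemma prm_cylinders_measurable C : prm_cylinders C `<=` measurable.
Proof.
move=> _ [m [A [B [mA _ mB ->]]]]; apply: fin_bigcap_measurable => // i _.
exact: measurable_preN.
Qed.

Lemma prm_cylindersI C : setI_closed (prm_cylinders C).
Proof.
move=> _ _ [m1 [A1 [B1 [mA1 A1C mB1 ->]]]] [m2 [A2 [B2 [mA2 A2C mB2 ->]]]].
pose c T (f1 : 'I_m1 -> T) (f2 : 'I_m2 -> T) (i : 'I_(m1 + m2)) : T :=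
  match fintype.split i with inl j => f1 j | inr j => f2 j end.
exists (m1 + m2)%N, (c _ A1 A2), (c _ B1 B2); split.
- by move=> i; rewrite /c; case: fintype.split.
- by move=> i; rewrite /c; case: fintype.split.
- by move=> i; rewrite /c; case: fintype.split.
apply/seteqP; split=> [w [h1 h2] i _|w h].
  by rewrite /c; case: fintype.split => j; [exact: h1|exact: h2].
split=> j _.
  by have := h (lshift m2 j) I; rewrite /c (unsplitK (inl j)).
by have := h (rshift m1 j) I; rewrite /c (unsplitK (inr j)).
Qed.

(* Refining the sets defining the cylinder into disjoint atoms turns the event
   into a countable union of product events. *)
Lemma prm_indep_cylinder (A C : set E) (V : set (\bar R)) (G : set Omega) :
  measurable A -> A `&` C = set0 -> measurable V -> prm_cylinders C G ->
  P (N ^~ A @^-1` V `&` G) = P (N ^~ A @^-1` V) * P G.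
Proof.
move=> mA AC0 mV [m [A_ [B_ [mA_ A_C mB_ ->]]]].
have AA_ i : A_ i `<=` ~` A.
  move=> z Az zA; have : (A `&` C) z by split => //; exact: (A_C i). by rewrite AC0.
(* Cutting with the complement of [A] keeps every atom, also the one of the empty [S], disjoint from
   [A]. Nothing of [A_ i] is lost, by [AA_]. *)
pose atom (S : {set 'I_m}) : set E :=
  (\bigcap_i (if i \in S then A_ i else ~` A_ i)) `&` ~` A.
have matom S : measurable (atom S).
  apply: measurableI; last exact: measurableC.
  apply: fin_bigcap_measurable => // i _; case: ifP => _ //.
  exact: measurableC.
have atom_inj S S' z : atom S z -> atom S' z -> S = S'.
  move=> [h _] [h' _]; apply/setP => i.
  have := h i I; have := h' i I.
  by case: ifPn; case: ifPn => // _ _ zA /(_ zA).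
have tatom : trivIset setT atom.
  apply/trivIsetP => S S' _ _ SS'; rewrite -subset0 => z [zS zS'].
  by move/eqP : SS'; apply; exact: atom_inj zS zS'.
have NA_ i w : N w (A_ i) = \sum_(S \in [set S : {set 'I_m} | i \in S]) N w (atom S).
  rewrite -measure_fin_bigcup//; [|exact: finite_finset|exact: sub_trivIset tatom].
  congr (N w _); apply/seteqP; split=> z.
    move=> zA; exists [set j | `[< A_ j z >]]%SET; first by rewrite /= inE; apply/asboolP.
    split; last exact: (AA_ i).
    by move=> j _; rewrite inE; case: ifPn => /asboolP.
  by move=> [S /= iS [/(_ i I)]]; rewrite iS.
(* [N] takes values in the natural numbers and infinity, so a vector of values on the atoms lies in
   the countable type [K], which [pickle] enumerates. [good] selects the vectors whose sums fall
   into all the [B_ i]. *)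
pose val (o : option nat) : \bar R := if o is Some k then k%:R%:E else +oo.
have val_inj : injective val.
  by move=> [k|] [l|] //= -[] /eqP; rewrite eqr_nat => /eqP ->.
have Nval : forall w (B : set E), measurable B -> exists o, N w B = val o.
  move=> w B mB; have [hN _ _ _] := pN; have [->|[k ->]] := hN w B mB.
    by exists None.
  by exists (Some k).
pose K := {ffun {set 'I_m} -> option nat}.
pose cell (v : K) := \bigcap_S (N ^~ (atom S) @^-1` [set val (v S)]).
pose good (v : K) := forall i, B_ i (\sum_(S \in [set S : {set 'I_m} | i \in S]) val (v S)).
pose F k := if (pickle_inv k : option K) is Some v then
   if `[< good v >] then cell v else set0 else set0.
have GF : \bigcap_i (N ^~ (A_ i) @^-1` B_ i) = \bigcup_k F k.
  apply/seteqP; split=> w.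
    move=> h; have /choice[v vE] S := Nval w _ (matom S).
    pose v' : K := [ffun S => v S].
    exists (pickle v') => //; rewrite /F pickleK_inv asboolT.
      by move=> S _ /=; rewrite ffunE vE.
    move=> i; have /= := h i I; rewrite NA_.
    by under eq_fsbigr do rewrite vE -[v _](ffunE v).
  move=> [k _]; rewrite /F; case: pickle_inv => // v; case: asboolP => // gv wv.
  move=> i _ /=; rewrite NA_.
  under eq_fsbigr do rewrite (wv _ I).
  exact: gv.
have m1 (x : \bar R) : measurable [set x] by exact: emeasurable_set1.
have mcell v : measurable (cell v).
  by apply: fin_bigcap_measurable => // S _; exact: measurable_preN.
have mF k : measurable (F k).
  by rewrite /F; case: pickle_inv => // v; case: ifP.
have tF : trivIset setT F.
  apply/trivIsetP => i j _ _ ij; rewrite -subset0 => w [].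
  rewrite /F; case Ei : pickle_inv => [v|//]; case: ifP => // _ wv.
  case Ej : pickle_inv => [v'|//]; case: ifP => // _ wv'.
  move/eqP : ij; apply.
  have := @pickle_invK K i; have := @pickle_invK K j.
  rewrite Ei Ej /= => <- <-; congr (pickle _); apply/ffunP => S; apply: val_inj.
  by have /= <- := wv S I; have /= <- := wv' S I.
set X := N ^~ A @^-1` V; have mX : measurable X by exact: measurable_preN.
have XF k : P (X `&` F k) = P X * P (F k).
  rewrite /F; case: pickle_inv => [v|]; last by rewrite setI0 measure0 mule0.
  case: ifP => _; last by rewrite setI0 measure0 mule0.
  (* [A] joins the atoms under the index [None]. The product formula is used twice, with [V] and
     with [setT] at this index, and the two results are compared. *)
  pose A' (o : option {set 'I_m}) := if o is Some U then atom U else A.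
  pose B' (W : set (\bar R)) (o : option {set 'I_m}) :=
    if o is Some U then [set val (v U)] else W.
  have mA' o : measurable (A' o) by case: o.
  have tA' : trivIset setT A'.
    apply/trivIsetP => -[S|] [S'|]//= _ _ SS'; last 2 first.
      by rewrite -subset0 => z [[_]].
      by rewrite -subset0 => z [? [_]].
    by apply: (trivIsetP.1 tatom) => //; apply: contra_neq SS' => ->.
  have mB' W o : measurable W -> measurable (B' W o) by move=> ?; case: o => [?|]; [exact: m1|].
  have cap W : (N ^~ A @^-1` W) `&` cell v = \bigcap_o (N ^~ (A' o) @^-1` B' W o).
    apply/seteqP; split=> [w [wW h] [S|] _ //|w h]; first exact: h.
    by split=> [|S _]; [exact: (h None)|exact: (h (Some S))].
  have -> : cell v = (N ^~ A @^-1` setT) `&` cell v by rewrite setTI.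
  rewrite setIA setIT (cap V) (cap setT) !prm_indep_fin//; [|by move=> o; exact: mB'..].
  rewrite (bigD1 None)//= [in RHS](bigD1 None)//=.
  rewrite preimage_setT probability_setT mul1e; congr (_ * _).
  by apply: eq_bigr => -[].
rewrite GF setI_bigcupr !measure_bigcup//.
- rewrite (eq_eseriesr (fun k _ => XF k)) -(@fineK _ (P X)) ?fin_num_measure//.
  by rewrite nneseriesZl.
- by move=> k _; exact: measurableI.
- exact: trivIset_setIl.
Qed.

End poisson_random_measure.

Section adapted.
Context {R : realType} d (Omega : measurableType d) (P : probability Omega R).
Context d' (E : measurableType d') (N : R.-ker Omega ~> E)
  (mu : {measure set E -> \bar R}).
Hypothesis pN : poisson_random_measure P N mu.
Local Open Scope ereal_scope.

(** As functions of [G], both sides are finite measures. They agree on the cylinders, a class stable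
    under intersection that contains the whole space (take [m = 0]), hence on the generated
    sigma-algebra. *)
Lemma prm_indep_sigma (A C : set E) (V : set (\bar R)) (G : set Omega) :
  measurable A -> A `&` C = set0 -> measurable V ->
  <<s prm_cylinders N C >> G ->
  P (N ^~ A @^-1` V `&` G) = P (N ^~ A @^-1` V) * P G.
Proof.
move=> mA AC mV sG.
have mX : measurable (N ^~ A @^-1` V).
  by rewrite -[X in measurable X]setTI; exact: measurable_kernel.
pose p : {nonneg R} := NngNum (fine_ge0 (measure_ge0 P (N ^~ A @^-1` V))).
rewrite setIC; have := @g_sigma_algebra_measure_unique _ R Omega (prm_cylinders N C)
  (@prm_cylinders_measurable _ _ _ _ _ N C) (fun=> setT) _ _
  (mrestr P mX) (mscale p P) (@prm_cylindersI _ _ _ _ _ N C) _ _ G sG.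
rewrite /= /mrestr /mscale /= fineK ?fin_num_measure//; apply.
- move=> _; exists 0%N, (fun=> set0), (fun=> setT); split => //; first by case.
  by apply/seteqP; split=> // w _ [].
- by rewrite bigcup_const//; exists 0%N.
- by move=> H cH; rewrite setIC (prm_indep_cylinder pN mA AC).
- by move=> _; rewrite setTI ltey_eq fin_num_measure.
Qed.

(* Measurability for the sigma-algebra generated by the restriction of [N] to [C]. *)
Definition adapted (C : set E) d1 (T : measurableType d1) (Y : Omega -> T) :=
  @measurable_fun _ _ (g_sigma_algebraType (prm_cylinders N C)) T setT Y.

Lemma adapted_measurable C d1 (T : measurableType d1) (Y : Omega -> T) :
  adapted C Y -> measurable_fun setT Y.
Proof.
move=> aY _ B mB; rewrite setTI.
have := aY measurableT B mB; rewrite setTI.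
apply: smallest_sub; first exact: sigma_algebra_measurable.
exact: prm_cylinders_measurable.
Qed.

Lemma sub_adapted C C' d1 (T : measurableType d1) (Y : Omega -> T) :
  C `<=` C' -> adapted C Y -> adapted C' Y.
Proof.
move=> CC' aY _ B mB; have := aY measurableT B mB.
apply: sub_sigma_algebra2 => _ [m [A [V [mA AC mV ->]]]].
by exists m, A, V; split => // i; exact: subset_trans (AC i) CC'.
Qed.

Lemma adapted_kernel (A C : set E) : measurable A -> A `<=` C ->
  adapted C (fun w => N w A).
Proof.
move=> mA AC _ B mB; rewrite setTI; apply: sub_sigma_algebra.
exists 1%N, (fun=> A), (fun=> B); split => //.
by apply/seteqP; split=> [w wB i _|w /(_ ord0 I)].
Qed.

(** The restriction of [N] to [D] is regarded as a kernel whose source carries the sigma-algebra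
    generated by [N] on [C]; the measurability of integrals against kernels, applied to it, is
    adaptedness. *)
Lemma adapted_Rintegral (D C : set E) (f : E -> R) : measurable D -> D `<=` C ->
  measurable_fun setT f -> adapted C (fun w => (\int[N w]_(x in D) f x)%R).
Proof.
move=> mD DC mf.
pose l (w : g_sigma_algebraType (prm_cylinders N C)) : measure E R :=
  mrestr (N w) mD.
have ml U : measurable U -> measurable_fun setT (l ^~ U).
  move=> mU; apply: adapted_kernel; first exact: measurableI.
  by move=> z [_ /DC].
have key (g : E -> \bar R) : measurable_fun setT g -> (forall x, 0 <= g x) ->
    adapted C (fun w => \int[N w]_(x in D) g x).
  move=> mg g0.
  rewrite [X in adapted _ X](_ : _ = (fun w => \int[l w]_x (g \_ D) x)).
    apply: measurable_fun_integral_kernel => //.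
      by move=> z; rewrite erestrict_ge0.
    by apply/(measurable_restrictT _ mD); exact: measurable_funTS.
  apply/funext => w; rewrite -integral_mkcond.
  apply: eq_measure_integral => A mA AD.
  by rewrite /l/= /mrestr setIidl.
rewrite /Rintegral.
apply: (measurableT_comp (fine_measurable measurableT)).
rewrite [X in measurable_fun _ X](_ : _ = (fun w =>
  \int[N w]_(x in D) (EFin \o f)^\+ x - \int[N w]_(x in D) (EFin \o f)^\- x)).
  apply: emeasurable_funB; apply: key => //.
    by apply: measurable_funepos; exact/measurable_EFinP.
  by apply: measurable_funeneg; exact/measurable_EFinP.
by apply/funext => w; rewrite integralE.
Qed.

Lemma adapted_indep (A C : set E) d1 (T : measurableType d1) (Y : Omega -> T)
    (f1 : \bar R -> \bar R) (f2 : T -> \bar R) :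
  measurable A -> A `&` C = set0 -> adapted C Y ->
  measurable_fun setT f1 -> measurable_fun setT f2 ->
  (forall x, 0 <= f1 x) -> (forall x, 0 <= f2 x) ->
  \int[P]_w (f1 (N w A) * f2 (Y w)) =
  \int[P]_w f1 (N w A) * \int[P]_w f2 (Y w).
Proof.
move=> mA AC aY mf1 mf2 f10 f20.
apply: (ge0_integral_indep (X1 := fun w => N w A)) => //.
- exact: measurable_kernel.
- exact: adapted_measurable aY.
- move=> V B mV mB; apply: (prm_indep_sigma mA AC mV).
  by have := aY measurableT B mB; rewrite setTI.
Qed.

End adapted.

(** * Moments of a Poisson variable *)

Section poisson_moments.
Context {R : realType} d (Omega : measurableType d) (P : probability Omega R).
Context d' (E : measurableType d') (N : R.-ker Omega ~> E)
  (mu : {measure set E -> \bar R}).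
Hypothesis pN : poisson_random_measure P N mu.
Context (A : set E).
Hypotheses (mA : measurable A) (finA : (mu A < +oo)%E).

Let l := fine (mu A).
(* Valid also for [l = 0], where [0 ^+ 0 = 1] gives the Dirac mass at [0]. *)
Let p (k : nat) : R := l ^+ k / k`!%:R * expR (- l).

Let l_ge0 : 0 <= l. Proof. by rewrite fine_ge0. Qed.

Let p_ge0 k : 0 <= p k.
Proof. by rewrite mulr_ge0 ?expR_ge0// divr_ge0// exprn_ge0. Qed.

Let poisson_pE k : poisson_prob l 0 [set k] = (p k)%:E.
Proof.
rewrite /poisson_prob /p; case: ifPn => [l0|].
  by rewrite esum_set1 ?lee_fin ?poisson_pmf_ge0// /poisson_pmf l0.
rewrite -leNgt => l0; have /eqP -> : l == 0 by rewrite eq_le l0 l_ge0.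
rewrite oppr0 expR0 mulr1 diracE; case: k => [|k].
  by rewrite mem_set//= expr0 fact0 divr1.
by rewrite memNset//= expr0n mul0r.
Qed.

Let NAk k : P [set w | N w A = k%:R%:E] = (p k)%:E.
Proof. by have [_ /(_ A mA finA k) -> _ _] := pN; exact: poisson_pE. Qed.

Let mNA V : measurable V -> measurable (N ^~ A @^-1` V).
Proof. by move=> mV; rewrite -[X in measurable X]setTI; exact: measurable_kernel. Qed.

Let mNAk (x : \bar R) : measurable [set w | N w A = x].
Proof. exact: (mNA (emeasurable_set1 x)). Qed.

Let S k := if k is k'.+1 then [set w | N w A = k'%:R%:E]
           else [set w | N w A = +oo%E].

Let mS k : measurable (S k). Proof. by case: k => [|k]; exact: mNAk. Qed.

Let tS : trivIset setT S.
Proof.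
move=> [|i] [|j] _ _ [w []] //=; first by move=> ->.
  by move=> + Ny; rewrite Ny.
by move=> -> -[] /eqP; rewrite eqr_nat => /eqP ->.
Qed.

Let US : \bigcup_k S k = setT.
Proof.
apply/seteqP; split=> // w _; have [hN _ _ _] := pN.
by have [h|[k h]] := hN w A mA; [exists 0%N|exists k.+1].
Qed.

Let sum_p : (\sum_(k <oo) (p k)%:E = 1)%E.
Proof.
have <- : poisson_prob l 0 setT = 1%E := probability_setT (poisson_prob l 0).
rewrite (_ : setT = \bigcup_n [set n]); last first.
  by apply/seteqP; split=> // n _; exists n.
transitivity (\sum_(k <oo | k \in [set: nat]) poisson_prob l 0 [set k])%E.
  rewrite [RHS]eseries_mkcond; apply: eq_eseriesr => k _.
  by rewrite in_setT poisson_pE.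
apply/esym; apply: measure_bigcup => // i j _ _ [x [-> ->]] //.
Qed.

Let series_recl (f : nat -> \bar R) : (forall k, 0 <= f k)%E ->
  (\sum_(k <oo) f k = f 0%N + \sum_(k <oo) f k.+1)%E.
Proof.
move=> f0; rewrite nneseries_recl//; congr (_ + _)%E.
by rewrite -(nneseries_addn 1)//; apply: eq_eseriesr => k _; rewrite addn1.
Qed.

(** The finite values already carry total mass one by [sum_p], and the [S k] partition the space, so
    nothing is left for the value infinity. *)
Let NAoo : P [set w | N w A = +oo%E] = 0%E.
Proof.
have : (P setT = \sum_(k <oo) P (S k))%E.
  by rewrite -US measure_semi_bigcup// US.
rewrite probability_setT series_recl// [X in (_ + X)%E](eq_eseriesr (g := fun k => (p k)%:E)).
  rewrite sum_p /S -[P _]fineK ?fin_num_measure// -EFinD => -[] h.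
  by congr EFin; lra.
by move=> k _; exact: NAk.
Qed.

Lemma ae_fin_num_kernel : {ae P, forall w, N w A \is a fin_num}.
Proof.
exists [set w | N w A = +oo%E]; split => // w /= h.
by apply: contrapT => h'; apply: h; rewrite ge0_fin_numE// ltey; apply/eqP.
Qed.

Lemma poisson_expectation (g : R -> R) : measurable_fun setT g ->
  (forall x, 0 <= g x) ->
  (\int[P]_w (g (fine (N w A)))%:E =
   \sum_(k <oo) (g k%:R * (l ^+ k / k`!%:R * expR (- l)))%:E)%E.
Proof.
move=> mg g0.
have mf : measurable_fun setT (fun w => (g (fine (N w A)))%:E).
  apply/measurable_EFinP; apply: (measurableT_comp mg).
  apply: (measurableT_comp (fine_measurable measurableT)).
  exact: measurable_kernel.
rewrite -US ge0_integral_bigcup//; last 2 first.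
- by rewrite US.
- by move=> w _; rewrite lee_fin.
have cst (x : \bar R) : (\int[P]_(w in [set w | N w A = x])
    (g (fine (N w A)))%:E = (g (fine x))%:E * P [set w | N w A = x])%E.
  rewrite -integral_cst//; apply: eq_integral => w.
  by rewrite inE /= => ->.
rewrite series_recl//; last first.
  by move=> k; apply: integral_ge0 => w _; rewrite lee_fin.
rewrite {1}/S cst// NAoo mule0 add0e; apply: eq_eseriesr => k _.
by rewrite /S cst// NAk EFinM.
Qed.

(** The recursion behind both moments: it turns the series for the mean into [l] times the total
    mass, and the one for the second moment into [l] times the mean plus the mass. *)
Let pS k : k.+1%:R * p k.+1 = l * p k.
Proof.
have k1 : k.+1%:R != 0 :> R by rewrite pnatr_eq0.
have k0 : k`!%:R != 0 :> R by rewrite pnatr_eq0 -lt0n fact_gt0.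
rewrite /p exprS factS natrM; move: (k.+1%:R) (k`!%:R) k1 k0 => a b a0 b0.
by field; rewrite a0 b0.
Qed.

Lemma poisson_mean : (\int[P]_w (fine (N w A))%:E = l%:E)%E.
Proof.
rewrite (eq_integral (fun w => `|fine (N w A)|%:E)) => [|w _]; last first.
  by rewrite ger0_norm// fine_ge0.
rewrite (poisson_expectation (g := Num.norm))// series_recl; last first.
  by move=> k; rewrite lee_fin mulr_ge0//; exact: p_ge0.
rewrite normr0 mul0r add0e.
under eq_eseriesr do rewrite normr_nat -/(p _.+1) pS EFinM.
by rewrite nneseriesZl ?sum_p ?mule1// => k _; rewrite lee_fin p_ge0.
Qed.

Lemma poisson_second_moment :
  (\int[P]_w (fine (N w A) ^+ 2)%:E = (l ^+ 2 + l)%:E)%E.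
Proof.
rewrite (poisson_expectation (g := fun x => x ^+ 2))//; last first.
  by move=> x; exact: sqr_ge0.
rewrite series_recl; last first.
  by move=> k; rewrite lee_fin mulr_ge0 ?sqr_ge0//; exact: p_ge0.
rewrite expr0n/= mul0r add0e.
have -> : (\sum_(k <oo) (k.+1%:R ^+ 2 * (l ^+ k.+1 / k.+1`!%:R * expR (- l)))%:E =
    \sum_(k <oo) (l%:E * ((k%:R * p k)%:E + (p k)%:E)))%E.
  apply: eq_eseriesr => k _; rewrite expr2 -mulrA -/(p _.+1) pS.
  by rewrite -EFinD -EFinM -natr1; congr EFin; ring.
rewrite nneseriesZl; last by move=> k _; rewrite lee_fin addr_ge0// mulr_ge0.
rewrite nneseriesD; last 2 first.
- by move=> k _; rewrite lee_fin mulr_ge0.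
- by move=> k _; rewrite lee_fin p_ge0.
rewrite sum_p series_recl; last by move=> k; rewrite lee_fin mulr_ge0 ?p_ge0.
rewrite mul0r add0e.
under eq_eseriesr do rewrite pS EFinM.
rewrite nneseriesZl ?sum_p ?mule1; last by move=> k _; rewrite lee_fin p_ge0.
by rewrite -EFinD -EFinM; congr EFin; ring.
Qed.

End poisson_moments.

(** * Compensated measures of sets *)

Lemma max0_split (R : realType) (x : R) :
  x = Num.max x 0 - Num.max (- x) 0 /\ `|x| = Num.max x 0 + Num.max (- x) 0.
Proof.
have [h|h] := lerP 0 x.
  have -> : Num.max (- x) 0 = 0 by apply: max_r; rewrite oppr_le0.
  by rewrite subr0 addr0 ger0_norm.
rewrite max_l ?oppr_ge0 ?ltW// ltr0_norm//.
by rewrite sub0r add0r opprK.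
Qed.

Section real_integrable.
Context {R : realType} d (T : measurableType d) (P : {finite_measure set T -> \bar R}).
Implicit Types f g : T -> R.

Lemma integrable_sqr_integrable f : measurable_fun setT f ->
  P.-integrable setT (EFin \o (fun x => f x ^+ 2)) ->
  P.-integrable setT (EFin \o f).
Proof.
move=> mf if2.
have i1 : P.-integrable setT (EFin \o cst (1 : R)).
  exact: finite_measure_integrable_cst.
apply: (le_integrable measurableT _ _ (integrableD measurableT if2 i1)) => /=.
  exact/measurable_EFinP.
move=> x _; rewrite lee_fin [leRHS]ger0_norm.
  have := sqr_ge0 (`|f x| - 1); rewrite sqrrB1 real_normK ?num_real//.
  by have := normr_ge0 (f x); nra.
by rewrite addr_ge0// sqr_ge0.
Qed.

Lemma integrable_sqrM f g : measurable_fun setT f -> measurable_fun setT g ->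
  P.-integrable setT (EFin \o (fun x => f x ^+ 2)) ->
  P.-integrable setT (EFin \o (fun x => g x ^+ 2)) ->
  P.-integrable setT (EFin \o (fun x => f x * g x)).
Proof.
move=> mf mg if2 ig2.
apply: (le_integrable measurableT _ _ (integrableD measurableT if2 ig2)) => /=.
  by apply/measurable_EFinP; exact: measurable_funM.
move=> x _; rewrite lee_fin [leRHS]ger0_norm.
  rewrite normrM -(real_normK (num_real (f x))) -(real_normK (num_real (g x))).
  have := sqr_ge0 (`|f x| - `|g x|); rewrite sqrrB.
  by have := normr_ge0 (f x); have := normr_ge0 (g x); nra.
by rewrite addr_ge0// sqr_ge0.
Qed.

End real_integrable.

Lemma Rintegral_probability_cst (R : realType) d (T : measurableType d)
  (P : probability T R) (r : R) : \int[P]_w r = r.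
Proof.
rewrite Rintegral_cst// [X in fine X](_ : _ = 1%E) ?mulr1//.
exact: probability_setT.
Qed.

Section compensated_kernel.
Context {R : realType} d (Omega : measurableType d) (P : probability Omega R).
Context d' (E : measurableType d') (N : R.-ker Omega ~> E)
  (mu : {measure set E -> \bar R}).

(** [fine] maps infinity to 0. This is harmless when [mu A] is finite, since [N w A] is then almost
    surely finite. *)
Definition compensated (A : set E) (w : Omega) : R :=
  fine (N w A) - fine (mu A).

Hypothesis pN : poisson_random_measure P N mu.

Let measurable_X (A : set E) : measurable A ->
  measurable_fun setT (fun w => fine (N w A)).
Proof.
move=> mA; apply: (measurableT_comp (fine_measurable measurableT)).
exact: measurable_kernel.
Qed.

Lemma measurable_compensated (A : set E) : measurable A ->
  measurable_fun setT (compensated A).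
Proof.
by move=> mA; apply: measurable_funB; [exact: measurable_X|exact: measurable_cst].
Qed.

Lemma adapted_compensated (A C : set E) : measurable A -> A `<=` C ->
  adapted N C (compensated A).
Proof.
move=> mA AC; apply: measurable_funB; last exact: measurable_cst.
apply: (measurableT_comp (fine_measurable measurableT)).
exact: adapted_kernel.
Qed.

Context (A : set E).
Hypotheses (mA : measurable A) (finA : (mu A < +oo)%E).
Let X w := fine (N w A).
Let l := fine (mu A).

Let l_ge0 : 0 <= l. Proof. by rewrite fine_ge0. Qed.
Let X_ge0 w : 0 <= X w. Proof. by rewrite fine_ge0. Qed.

Lemma integrable_kernel : P.-integrable setT (EFin \o X).
Proof.
apply/integrableP; split; first exact/measurable_EFinP/measurable_X.
rewrite (eq_integral (fun w => (X w)%:E)) => [|w _]; last first.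
  by rewrite abse_EFin ger0_norm.
by rewrite (poisson_mean pN)// ltry.
Qed.

Lemma integrable_kernel2 :
  P.-integrable setT (EFin \o (fun w => X w ^+ 2)).
Proof.
apply/integrableP; split.
  by apply/measurable_EFinP; apply: measurable_funX; exact: measurable_X.
rewrite (eq_integral (fun w => (X w ^+ 2)%:E)) => [|w _]; last first.
  by rewrite abse_EFin ger0_norm// sqr_ge0.
by rewrite (poisson_second_moment pN)// ltry.
Qed.

Lemma integrable_compensated : P.-integrable setT (EFin \o compensated A).
Proof.
exact: (integrableB measurableT integrable_kernel
  (finite_measure_integrable_cst P l measurableT)).
Qed.

Let compensated_sqrE w :
  compensated A w ^+ 2 = X w ^+ 2 + (- (2 * l)) * X w + l ^+ 2.
Proof. by rewrite /compensated -/(X w) -/l; ring. Qed.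

Lemma integrable_compensated2 :
  P.-integrable setT (EFin \o (fun w => compensated A w ^+ 2)).
Proof.
under [X in _.-integrable _ X]eq_fun do rewrite /= compensated_sqrE.
exact: (integrableD measurableT (integrableD measurableT integrable_kernel2
  (integrableZl measurableT (- (2 * l)) integrable_kernel))
  (finite_measure_integrable_cst P (l ^+ 2) measurableT)).
Qed.

Lemma Rintegral_compensated2 : \int[P]_w (compensated A w ^+ 2) = l.
Proof.
under eq_Rintegral do rewrite compensated_sqrE.
have i2 := integrable_kernel2.
have i1 := integrableZl measurableT (- (2 * l)) integrable_kernel.
rewrite RintegralD//; [|exact: (integrableD measurableT i2 i1)|
  exact: finite_measure_integrable_cst].
rewrite RintegralD// RintegralZl//; last exact: integrable_kernel.
rewrite Rintegral_probability_cst /Rintegral.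
rewrite (poisson_mean pN)// (poisson_second_moment pN)//= -/l.
by ring.
Qed.

Section orthogonality.
Context (C : set E) (AC : A `&` C = set0) d1 (T : measurableType d1)
  (Y : Omega -> T) (phi : T -> R).
Hypotheses (aY : adapted N C Y) (mphi : measurable_fun setT phi)
  (iphi : P.-integrable setT (EFin \o (phi \o Y))).

Let mY : measurable_fun setT Y. Proof. exact: adapted_measurable aY. Qed.

Let ge0_indep (psi : T -> R) : measurable_fun setT psi ->
  (forall y, 0 <= psi y) ->
  (\int[P]_w (psi (Y w) * X w)%:E = l%:E * \int[P]_w (psi (Y w))%:E)%E.
Proof.
move=> mpsi psi0.
(* [adapted_indep] asks for a function nonnegative on all of [\bar R]; on the values of [N] the
   absolute value changes nothing. *)
have mf1 : measurable_fun setT (fun x : \bar R => `|fine x|%:E).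
  apply/measurable_EFinP.
  exact: (measurableT_comp (@normr_measurable R setT) (fine_measurable measurableT)).
have mf2 : measurable_fun setT (EFin \o psi) by exact/measurable_EFinP.
have f1X w : (`|fine (N w A)|%:E = (X w)%:E)%E by rewrite ger0_norm.
transitivity (\int[P]_w (`|fine (N w A)|%:E * (psi (Y w))%:E))%E.
  by apply: eq_integral => w _; rewrite f1X -EFinM mulrC.
rewrite (adapted_indep pN mA AC aY mf1 mf2)//.
congr (_ * _)%E; rewrite -(poisson_mean pN mA finA).
by apply: eq_integral => w _; rewrite f1X.
Qed.

Lemma integrable_adapted_kernel :
  P.-integrable setT (EFin \o (fun w => phi (Y w) * X w)).
Proof.
have mphiY : measurable_fun setT (fun w => phi (Y w)).
  exact: measurableT_comp mphi mY.
apply/integrableP; split.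
  by apply/measurable_EFinP; apply: measurable_funM => //; exact: measurable_X.
rewrite (eq_integral (fun w => (`|phi (Y w)| * X w)%:E)) => [|w _]; last first.
  by rewrite abse_EFin normrM (ger0_norm (X_ge0 w)).
rewrite (ge0_indep (psi := fun y => `|phi y|))//; last exact: measurableT_comp.
move/integrableP : iphi => [_]; under eq_integral do rewrite abse_EFin.
by move=> h; rewrite lte_mul_pinfty// lee_fin.
Qed.

(** Independence is available for nonnegative functions only, hence the split of [phi] into positive
    and negative part. For each part the expectation of [psi (Y w) * X w] is [l] times that of
    [psi (Y w)], which the compensator cancels. *)
Lemma Rintegral_adapted_compensated :
  \int[P]_w (phi (Y w) * compensated A w) = 0.
Proof.
pose pp (y : T) : R := Num.max (phi y) 0; pose pn (y : T) : R := Num.max (- phi y) 0.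
have mpp : measurable_fun setT pp by exact: measurable_maxr.
have mpn : measurable_fun setT pn.
  by apply: measurable_maxr => //; exact: measurable_funN.
have pp0 y : 0 <= pp y by rewrite le_max lexx orbT.
have pn0 y : 0 <= pn y by rewrite le_max lexx orbT.
have phiE y : phi y = pp y - pn y by have [] := max0_split (phi y).
have ppn y : `|phi y| = pp y + pn y by have [] := max0_split (phi y).
have ip (psi : T -> R) : measurable_fun setT psi -> (forall y, 0 <= psi y) ->
    (forall y, psi y <= `|phi y|) ->
    P.-integrable setT (EFin \o (fun w => psi (Y w))) /\
    P.-integrable setT (EFin \o (fun w => psi (Y w) * X w)).
  move=> mpsi psi0 psile; split.
    apply: (le_integrable measurableT _ _ iphi) => /=.
      by apply/measurable_EFinP; exact: measurableT_comp.
    by move=> w _; rewrite lee_fin ger0_norm.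
  apply: (le_integrable measurableT _ _ integrable_adapted_kernel) => /=.
    apply/measurable_EFinP; apply: measurable_funM; last exact: measurable_X.
    exact: measurableT_comp.
  by move=> w _; rewrite lee_fin !normrM ger0_norm// ler_wpM2r.
have ppl y : pp y <= `|phi y| by rewrite ppn lerDl.
have pnl y : pn y <= `|phi y| by rewrite ppn lerDr.
have [ipp ippX] := ip pp mpp pp0 ppl.
have [ipn ipnX] := ip pn mpn pn0 pnl.
have indepE (psi : T -> R) : measurable_fun setT psi -> (forall y, 0 <= psi y) ->
    P.-integrable setT (EFin \o (fun w => psi (Y w))) ->
    \int[P]_w (psi (Y w) * X w) = l * \int[P]_w psi (Y w).
  move=> mpsi psi0 ipsi; rewrite /Rintegral ge0_indep// fineM//.
  exact: integrable_fin_num.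
under eq_Rintegral do rewrite /compensated -/(X _) -/l mulrBr phiE mulrBl.
rewrite RintegralB//; last 2 first.
- exact: (integrableB measurableT ippX ipnX).
- apply: (integrableZr measurableT l (integrableB measurableT ipp ipn)).
rewrite RintegralB// !indepE// RintegralZr//; last first.
  exact: (integrableB measurableT ipp ipn).
by rewrite RintegralB//; ring.
Qed.

End orthogonality.
End compensated_kernel.

Section compensated_sum.
Context {R : realType} d (Omega : measurableType d) (P : probability Omega R).
Context d' (E : measurableType d') (N : R.-ker Omega ~> E)
  (mu : {measure set E -> \bar R}).
Hypothesis pN : poisson_random_measure P N mu.
Local Notation cN := (compensated N mu).

Lemma adapted_sum (J : eqType) (s : seq J) (C : set E) (f : J -> Omega -> R) :
  (forall j, j \in s -> adapted N C (f j)) ->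
  adapted N C (fun w => \sum_(j <- s) f j w).
Proof.
elim: s => [|j s IH] h.
  under [X in adapted _ _ X]eq_fun do rewrite big_nil.
  exact: measurable_cst.
under [X in adapted _ _ X]eq_fun do rewrite big_cons.
apply: measurable_funD; first by apply: h; rewrite mem_head.
by apply: IH => i si; apply: h; rewrite in_cons si orbT.
Qed.

Let disjoint_sub (A B : set E) : A `&` B = set0 -> A `<=` ~` B.
Proof. by move=> AB x Ax Bx; have : (A `&` B) x by []; rewrite AB. Qed.

Section family.
Context (J : eqType) (B : J -> set E).
Hypotheses (mB : forall j, measurable (B j))
  (finB : forall j, (mu (B j) < +oo)%E).

(** Induction on the list: the sum over the tail is adapted to the complement of [B j], so its
    product with the new term has mean zero, and only the variances [mu (B j)] remain. *)
Lemma compensated_sum_isometry (s : seq J) (c : J -> R) : uniq s ->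
  {in s &, forall i j, i != j -> B i `&` B j = set0} ->
  P.-integrable setT
    (EFin \o (fun w => (\sum_(j <- s) c j * cN (B j) w) ^+ 2)) /\
  \int[P]_w ((\sum_(j <- s) c j * cN (B j) w) ^+ 2) =
  \sum_(j <- s) c j ^+ 2 * fine (mu (B j)).
Proof.
elim: s => [_ _|j s IH].
  under [X in _.-integrable _ X]eq_fun do
    rewrite /= big_nil expr0n/=.
  under eq_Rintegral do rewrite big_nil expr0n/=.
  rewrite big_nil Rintegral_probability_cst; split => //; exact: integrable0.
rewrite cons_uniq => /andP[js us] tB.
have {IH}[iS ES] : P.-integrable setT
    (EFin \o (fun w => (\sum_(j <- s) c j * cN (B j) w) ^+ 2)) /\
    \int[P]_w ((\sum_(j <- s) c j * cN (B j) w) ^+ 2) =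
    \sum_(j <- s) c j ^+ 2 * fine (mu (B j)).
  by apply: IH => // i k si sk; apply: tB; rewrite in_cons ?si ?sk orbT.
set S := fun w => \sum_(j <- s) c j * cN (B j) w in iS ES.
have aS : adapted N (~` B j) S.
  apply: adapted_sum => i si; apply: measurable_funM; first exact: measurable_cst.
  apply: adapted_compensated => //; apply: disjoint_sub.
  apply: tB; rewrite ?in_cons ?eqxx ?si ?orbT//.
  by apply: contraNneq js => <-.
have mS : measurable_fun setT S by exact: adapted_measurable aS.
have SE w : (\sum_(i <- j :: s) c i * cN (B i) w) ^+ 2 =
    S w ^+ 2 + 2 * c j * (S w * cN (B j) w) + c j ^+ 2 * cN (B j) w ^+ 2.
  by rewrite big_cons -/(S w); ring.
have i2 := integrable_compensated2 pN (mB j) (finB j).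
have iSc : P.-integrable setT (EFin \o (fun w => S w * cN (B j) w)).
  by apply: integrable_sqrM => //; exact: measurable_compensated.
have iSc' := integrableZl measurableT (2 * c j) iSc.
have i2' := integrableZl measurableT (c j ^+ 2) i2.
have iD := integrableD measurableT iS iSc'.
under [X in _.-integrable _ X]eq_fun do rewrite /= SE.
under eq_Rintegral do rewrite SE.
split; first exact: (integrableD measurableT iD i2').
rewrite RintegralD// RintegralD// !RintegralZl// ES.
rewrite (Rintegral_compensated2 pN)// big_cons.
rewrite (@Rintegral_adapted_compensated _ _ _ _ _ _ _ _ pN _ (mB j) (finB j)
  (~` B j) _ _ _ S id)//; first by rewrite mulr0 addr0 addrC.
- exact: setICr.
- exact: integrable_sqr_integrable.
Qed.

End family.

End compensated_sum.

(** * Adding independent jumps one at a time *)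

Section vector_valued.
Context {R : realType} {n : nat}.

Lemma measurable_rVD d (T : measurableType d) (f g : T -> 'rV[R]_n) :
  measurable_fun setT f -> measurable_fun setT g ->
  measurable_fun setT (fun x => f x + g x).
Proof.
move=> mf mg; apply: measurable_fun_coordP => i.
under eq_fun do rewrite mxE.
by apply: measurable_funD;
  apply: (measurableT_comp (@measurable_coord R n i)).
Qed.

Lemma measurable_rVZ d (T : measurableType d) (f : T -> R) (v : 'rV[R]_n) :
  measurable_fun setT f -> measurable_fun setT (fun x => f x *: v).
Proof.
move=> mf; apply: measurable_fun_coordP => i.
under eq_fun do rewrite mxE.
by apply: measurable_funM.
Qed.

(** [phi] is meant to be the derivative of [h] along [v]. One direction at a time is enough because
    each jump is a random scalar times a fixed vector; boundedness of [phi] makes the first-order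
    term integrable. *)
Definition taylor_bound (h : 'rV[R]_n -> R) (K beta : R) :=
  forall v : 'rV[R]_n, exists phi : 'rV[R]_n -> R,
    [/\ measurable_fun setT phi, exists M, forall y, `|phi y| <= M &
        forall y c, `|h (y + c *: v) - h y - c * phi y| <=
          K * `|c| `^ beta * enorm v `^ beta].

(** For [x >= 1] the square dominates, for [x <= 1] the linear term does. *)
Lemma powR_le_sqrD (x beta : R) : 1 <= beta <= 2 -> 0 <= x ->
  x `^ beta <= x ^+ 2 + x.
Proof.
move=> /andP[b1 b2] x0; have [x1|x1] := leP 1 x.
  by rewrite (le_trans (ler_powR x1 b2))// powR_mulrn// lerDl.
rewrite (@le_trans _ _ (x `^ 1))//; last by rewrite powRr1// lerDr sqr_ge0.
have [->|x00] := eqVneq x 0; first by rewrite !powR0 ?lexx// gt_eqF// (lt_le_trans ltr01).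
by apply: ger_powR => //; rewrite lt_neqAle eq_sym x00 x0 ltW.
Qed.

End vector_valued.

Section small_jumps.
Context {R : realType} d (Omega : measurableType d) (P : probability Omega R).
Context d' (E : measurableType d') (N : R.-ker Omega ~> E)
  (mu : {measure set E -> \bar R}).
Hypothesis pN : poisson_random_measure P N mu.
Local Notation cN := (compensated N mu).
Context {n : nat} (h : 'rV[R]_n -> R) (K beta M : R).
Hypotheses (mh : measurable_fun setT h) (hM : forall y, `|h y| <= M)
  (beta12 : 1 <= beta <= 2) (K0 : 0 <= K) (hK : taylor_bound h K beta).

Let integrable_bounded (f : Omega -> R) (M' : R) : measurable_fun setT f ->
  (forall w, `|f w| <= M') -> P.-integrable setT (EFin \o f).
Proof.
move=> mf fM; apply: measurable_bounded_integrable => //.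
  by rewrite -ge0_fin_numE// fin_num_measure.
by exists M'; split; [exact: num_real|move=> x Mx w _ /=; rewrite (le_trans (fM w))// ltW].
Qed.

Lemma integrable_comp_bounded (Y : Omega -> 'rV[R]_n) : measurable_fun setT Y ->
  P.-integrable setT (EFin \o (fun w => h (Y w))).
Proof.
by move=> mY; apply: (@integrable_bounded _ M); [exact: (measurableT_comp mh mY)|move=> w; exact: hM].
Qed.

Lemma small_jump (A C : set E) (Y : Omega -> 'rV[R]_n) (v : 'rV[R]_n) :
  measurable A -> (mu A < +oo)%E -> A `&` C = set0 -> adapted N C Y ->
  `|\int[P]_w h (Y w + cN A w *: v) - \int[P]_w h (Y w)| <=
  3 * K * (enorm v `^ beta * fine (mu A)).
Proof.
move=> mA finA AC aY; have [phi [mphi [M' phiM'] hphi]] := hK v.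
have mY := adapted_measurable aY.
have mc : measurable_fun setT (cN A) by exact: measurable_compensated.
have ih := integrable_comp_bounded mY.
have ih' : P.-integrable setT (EFin \o (fun w => h (Y w + cN A w *: v))).
  by apply: integrable_comp_bounded; apply: measurable_rVD => //; exact: measurable_rVZ.
have iphi : P.-integrable setT (EFin \o (phi \o Y)).
  by apply: (@integrable_bounded _ M'); [exact: (measurableT_comp mphi mY)|move=> w; exact: phiM'].
have ic := integrable_compensated pN mA finA.
have iphic : P.-integrable setT (EFin \o (fun w => phi (Y w) * cN A w)).
  apply: (le_integrable measurableT _ _ (integrableZl measurableT M' ic)) => /=.
    apply/measurable_EFinP; apply: measurable_funM => //.
    exact: (measurableT_comp mphi mY).
  move=> w _; rewrite lee_fin !normrM ler_wpM2r//.
  exact: le_trans (phiM' _) (ler_norm _).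
have ihB := integrableB measurableT ih' ih.
pose r w := h (Y w + cN A w *: v) - h (Y w) - phi (Y w) * cN A w.
have ir : P.-integrable setT (EFin \o r) := integrableB measurableT ihB iphic.
have -> : \int[P]_w h (Y w + cN A w *: v) - \int[P]_w h (Y w) = \int[P]_w r w.
  rewrite /r RintegralB// RintegralB//.
  by rewrite (Rintegral_adapted_compensated pN mA finA AC aY mphi iphi) subr0.
apply: le_trans (le_normr_Rintegral measurableT ir) _.
(* The source of the factor 3: the square contributes [mu A] (the variance), and |N - mu| <= N + mu
   contributes [mu A] twice. *)
pose g w := K * enorm v `^ beta * (cN A w ^+ 2 + (fine (N w A) + fine (mu A))).
have ic2 := integrable_compensated2 pN mA finA.
have iN := integrable_kernel pN mA finA.
have il := finite_measure_integrable_cst P (fine (mu A)) measurableT.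
have iNl := integrableD measurableT iN il.
have isum := integrableD measurableT ic2 iNl.
have ig : P.-integrable setT (EFin \o g).
  exact: (integrableZl measurableT (K * enorm v `^ beta) isum).
apply: (@le_trans _ _ (\int[P]_w g w)).
  apply: le_Rintegral => //; first exact: integrable_norm.
  move=> w _; rewrite /r mulrC; apply: le_trans (hphi _ _) _.
  rewrite /g mulrAC ler_wpM2l// ?mulr_ge0 ?powR_ge0//.
  apply: le_trans (powR_le_sqrD beta12 (normr_ge0 _)) _.
  rewrite real_normK ?num_real// lerD2l.
  rewrite (le_trans (ler_normB _ _))// !ger0_norm ?fine_ge0//.
rewrite RintegralZl// RintegralD// RintegralD//.
rewrite (Rintegral_compensated2 pN)// Rintegral_probability_cst.
have -> : \int[P]_w fine (N w A) = fine (mu A).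
  by rewrite /Rintegral (poisson_mean pN).
by rewrite le_eqVlt; apply/orP; left; apply/eqP; ring.
Qed.

Section telescope.
Context (J : eqType) (B : J -> set E).
Hypotheses (mB : forall j, measurable (B j))
  (finB : forall j, (mu (B j) < +oo)%E).

Lemma adapted_vector_sum (s : seq J) (C : set E) (v : J -> 'rV[R]_n) :
  (forall j, j \in s -> B j `<=` C) ->
  adapted N C (fun w => \sum_(j <- s) cN (B j) w *: v j).
Proof.
move=> h'; apply: measurable_fun_coordP => i.
under eq_fun do rewrite summxE; apply: adapted_sum => j js.
under [X in adapted _ _ X]eq_fun do rewrite mxE.
apply: measurable_funM; last exact: measurable_cst.
by apply: adapted_compensated => //; exact: h'.
Qed.

Lemma small_jumps (s : seq J) (C : set E) (Y : Omega -> 'rV[R]_n)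
    (v : J -> 'rV[R]_n) :
  uniq s -> {in s &, forall i j, i != j -> B i `&` B j = set0} ->
  (forall j, j \in s -> B j `&` C = set0) -> adapted N C Y ->
  `|\int[P]_w h (Y w + \sum_(j <- s) cN (B j) w *: v j) - \int[P]_w h (Y w)| <=
  3 * K * \sum_(j <- s) enorm (v j) `^ beta * fine (mu (B j)).
Proof.
move=> + + + aY; elim: s => [_ _ _|j s IH].
  by under eq_Rintegral do rewrite big_nil addr0; rewrite subrr normr0 big_nil mulr0.
rewrite cons_uniq => /andP[js us] tB BC.
have disj (A D : set E) : A `&` D = set0 -> D `<=` ~` A.
  by move=> AD x Dx Ax; have : (A `&` D) x by []; rewrite AD.
pose Y' w := Y w + \sum_(i <- s) cN (B i) w *: v i.
(* All that was added before lives on [C] or on some other [B i], both disjoint from [B j]; so [Y']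
   is independent of the next jump. *)
have aY' : adapted N (~` B j) Y'.
  apply: measurable_rVD.
    by apply: sub_adapted aY; apply/disj/BC; rewrite mem_head.
  apply: adapted_vector_sum => i si; apply: disj.
  apply: tB; rewrite ?in_cons ?eqxx ?si ?orbT//.
  by apply: contraNneq js => ->.
have -> : \int[P]_w h (Y w + \sum_(i <- j :: s) cN (B i) w *: v i) =
    \int[P]_w h (Y' w + cN (B j) w *: v j).
  by apply: eq_Rintegral => w _; rewrite big_cons /Y' -addrA (addrC (_ *: _)).
rewrite big_cons mulrDr.
rewrite -(subrKA (\int[P]_w h (Y' w))) (le_trans (ler_normD _ _))// lerD//.
  by apply: (small_jump _ _ _ (setICr _) aY').
apply: IH => //.
  by move=> i k si sk; apply: tB; rewrite in_cons ?si ?sk orbT.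
by move=> i si; apply: BC; rewrite in_cons si orbT.
Qed.

End telescope.

End small_jumps.

(** * Taylor estimates in Holder spaces *)

Section enorm_theory.
Context {R : realType} {n : nat}.
Implicit Types x y v : 'rV[R]_n.

Lemma enorm_ge0 x : 0 <= enorm x.
Proof. exact: sqrtr_ge0. Qed.

Lemma le_enorm x y : (forall i, `|x ord0 i| <= `|y ord0 i|) ->
  enorm x <= enorm y.
Proof.
move=> xy; apply: ler_wsqrtr; apply: ler_sum => i _.
by rewrite -real_normK ?num_real// -[leRHS]real_normK ?num_real// lerXn2r// nnegrE.
Qed.

Lemma enormZ (c : R) x : enorm (c *: x) = `|c| * enorm x.
Proof.
rewrite /enorm -(sqrtr_sqr c) -sqrtrM ?sqr_ge0// mulr_sumr.
by congr Num.sqrt; apply: eq_bigr => i _; rewrite mxE exprMn.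
Qed.

Lemma coord_le_enorm x i : `|x ord0 i| <= enorm x.
Proof.
rewrite -(sqrtr_sqr (x ord0 i)); apply: ler_wsqrtr.
by rewrite (bigD1 i)//= lerDl sumr_ge0// => j _; exact: sqr_ge0.
Qed.

Lemma enorm_gt0 y : y != 0 -> 0 < enorm y.
Proof.
move=> y0; have [j yj] : exists j, y ord0 j != 0.
  apply/existsP; rewrite -negb_forall; apply: contra_neqN y0 => /forallP h0.
  by apply/rowP => j; rewrite mxE; apply/eqP.
by rewrite (lt_le_trans _ (coord_le_enorm y j))// normr_gt0.
Qed.

(** The sigma-algebra is the one generated by the coordinates. Rounding each coordinate down to a
    multiple of 1/(k+1) makes [h] a function of countably many values, measurable cell by cell; the
    Lipschitz bound gives pointwise convergence as [k] grows. *)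
Lemma measurable_fun_lipschitz (h : 'rV[R]_n -> R) (L : R) :
  0 <= L ->
  (forall y v, `|h (y + v) - h y| <= L * \sum_i `|v ord0 i|) ->
  measurable_fun setT h.
Proof.
move=> L0 hL.
pose c k (x : 'rV[R]_n) : {ffun 'I_n -> int} :=
  [ffun i => Num.floor (k.+1%:R * x ord0 i)].
pose q k (z : {ffun 'I_n -> int}) : 'rV[R]_n := \row_i ((z i)%:~R / k.+1%:R).
have mc k z : measurable [set x | c k x = z].
  rewrite (_ : mkset _ = \bigcap_i (fun x : 'rV[R]_n => x ord0 i) @^-1`
      `[(z i)%:~R / k.+1%:R, (z i + 1)%:~R / k.+1%:R[).
    apply: fin_bigcap_measurable => // i _; rewrite -[X in measurable X]setTI.
    exact: measurable_coord.
  apply/seteqP; split=> [x <- i _|x h'] /=.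
    rewrite /c ffunE in_itv/= ler_pdivrMr// ltr_pdivlMr// (mulrC _ k.+1%:R).
    exact: floor_itv.
  apply/ffunP => i; rewrite ffunE; apply: floor_def.
  have /= := h' i I; rewrite in_itv/= ler_pdivrMr// ltr_pdivlMr//.
  by rewrite (mulrC _ k.+1%:R).
apply: (@measurable_fun_cvg _ _ _ _ (fun k x => h (q k (c k x)))) => [k|x _].
  move=> _ B mB; rewrite setTI.
  rewrite (_ : _ @^-1` _ = \bigcup_z
      (if `[< B (h (q k z)) >] then [set x | c k x = z] else set0)).
    apply: countable_bigcupT_measurable => [|z]; first exact: countableP.
    by case: ifP.
  apply/seteqP; split=> [x Bx|x [z _]] /=.
    by exists (c k x) => //; rewrite asboolT.
  by case: asboolP => // Bz /= ->.
apply/cvgrPdist_le => /= e e0.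
have den0 : 0 < L * n%:R + 1 by rewrite ltr_wpDl// mulr_ge0.
near=> k.
rewrite -{1}(subrK (q k (c k x)) x) [_ - _ + _]addrC.
apply: le_trans (hL _ _) _.
have xq i : `|(x - q k (c k x)) ord0 i| <= k.+1%:R^-1.
  rewrite !mxE ffunE ler_norml.
  have /andP[f1 f2] := floor_itv (k.+1%:R * x ord0 i).
  have k0 : 0 < k.+1%:R :> R by rewrite ltr0n.
  move: f1 f2; rewrite intrD => f1 f2.
  rewrite (_ : _ - _ = (k.+1%:R * x ord0 i - (Num.floor (k.+1%:R * x ord0 i))%:~R)
    / k.+1%:R); last by field; rewrite gt_eqF.
  rewrite ler_pdivrMr// mulVf ?gt_eqF//; apply/andP; split; last by lra.
  rewrite (@le_trans _ _ 0)// ?oppr_le0 ?invr_ge0 ?(ltW k0)// divr_ge0 ?(ltW k0)//.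
  by rewrite subr_ge0.
apply: (@le_trans _ _ (L * (n%:R * k.+1%:R^-1))).
  rewrite ler_wpM2l// (le_trans (ler_sum _ (fun i _ => xq i)))//.
  by rewrite sumr_const card_ord mulr_natl.
rewrite mulrA (@le_trans _ _ ((L * n%:R + 1) * k.+1%:R^-1))//.
  by rewrite ler_wpM2r// lerDl.
rewrite mulrC -ler_pdivlMr//; apply: ltW.
by near: k; apply: (near_infty_natSinv_lt (PosNum (divr_gt0 e0 den0))).
Unshelve. all: by end_near. Qed.

End enorm_theory.

Section holder_estimates.
Context {R : realType} {n : nat} (h : 'rV[R]_n -> R).
Local Notation e_ i := (delta_mx ord0 i : 'rV[R]_n).

Hypothesis dh : forall i x, derivable h x (e_ i).

Lemma line_MVT i (y : 'rV[R]_n) (c : R) : exists2 xi : R, `|xi| <= `|c| &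
  h (y + c *: e_ i) - h y = c * partial i h (y + xi *: e_ i).
Proof.
pose g (t : R) := h (y + t *: e_ i).
have qE t (u : R) : u^-1 *: ((g \o shift t) (u *: 1) - g t) =
    u^-1 *: ((h \o shift (y + t *: e_ i)) (u *: e_ i) - h (y + t *: e_ i)).
  rewrite /g /=; congr (_ *: (h _ - _)).
  by rewrite -[u *: 1]/(u * 1) mulr1 scalerDl addrCA.
have gd (t : R) : is_derive t 1 g (partial i h (y + t *: e_ i)).
  have dd : derivable g t 1.
    by rewrite /derivable; under eq_fun do rewrite qE; exact: dh.
  apply: DeriveDef => //.
  by rewrite /partial /derive; under eq_fun do rewrite qE.
have cont a b : {within `[a, b], continuous g}.
  by apply: derivable_within_continuous => t _; have [] := gd t.
have [c0|c0] := leP 0 c.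
  have [xi] := MVT_segment c0 (fun t _ => gd t) (cont 0 c).
  rewrite in_itv/= => /andP[xi0 xic] gE; exists xi.
    by rewrite !ger0_norm// (le_trans xi0).
  by move: gE; rewrite /g scale0r addr0 subr0 => ->; rewrite mulrC.
have [xi] := MVT_segment (ltW c0) (fun t _ => gd t) (cont c 0).
rewrite in_itv/= => /andP[cxi xi0] gE; exists xi.
  by rewrite !ler0_norm ?lerN2// ltW.
by rewrite -opprB; move: gE; rewrite /g scale0r addr0 sub0r => ->; ring.
Qed.

Lemma rV_decomp (v : 'rV[R]_n) : v = \sum_i v ord0 i *: e_ i.
Proof.
apply/rowP => j; rewrite summxE (bigD1 j)//= !mxE !eqxx mulr1 big1 ?addr0//.
by move=> i; rewrite eq_sym => ij; rewrite !mxE (negPf ij) andbF mulr0.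
Qed.

Lemma coord_partial_sum (v : 'rV[R]_n) (s : seq 'I_n) j : uniq s ->
  (\sum_(i <- s) v ord0 i *: e_ i) ord0 j = if j \in s then v ord0 j else 0.
Proof.
elim: s => [_|i s IH /= /andP[si us]]; first by rewrite big_nil mxE.
rewrite big_cons !mxE IH// in_cons eqxx/=.
have [->|ji] := eqVneq j i; first by rewrite mulr1 (negPf si) addr0.
by rewrite mulr0 add0r.
Qed.

(** The path from [y] to [y + v] follows the axes, with the mean value theorem on each edge. *)
Lemma lipschitz_of_partial (L : R) : (forall i x, `|partial i h x| <= L) ->
  forall y v, `|h (y + v) - h y| <= L * \sum_i `|v ord0 i|.
Proof.
move=> hL y v; rewrite {1}(rV_decomp v).
elim: (index_enum _) => [|i s IH]; first by rewrite !big_nil addr0 subrr normr0 mulr0.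
rewrite !big_cons [_ *: _ + _]addrC addrA.
set Y := y + _ in IH *; have [xi _ hxi] := line_MVT i Y (v ord0 i).
rewrite -(subrKA (h Y)) hxi.
rewrite mulrDr (le_trans (ler_normD _ _))// lerD// normrM mulrC.
by rewrite ler_wpM2r.
Qed.

(** On the same path along the axes, each mean value point differs from [y] by a vector whose
    coordinates are at most those of [v] in absolute value. The Holder bound thus applies at
    distance at most [enorm v] on each of the [n] edges, whence the factor [n]. *)
Lemma taylor_of_partial (H b : R) : 0 <= H -> 0 <= b ->
  (forall i x y, `|partial i h (x + y) - partial i h x| <= H * enorm y `^ b) ->
  forall y v, `|h (y + v) - h y - \sum_i v ord0 i * partial i h y| <=
    n%:R * H * enorm v `^ (b + 1).
Proof.
move=> H0 b0 hH y v.
have key (s : seq 'I_n) : uniq s ->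
    `|h (y + \sum_(i <- s) v ord0 i *: e_ i) - h y -
      \sum_(i <- s) v ord0 i * partial i h y| <=
    \sum_(i <- s) H * enorm v `^ (b + 1).
  elim: s => [_|i s IH /= /andP[si us]].
    by rewrite !big_nil addr0 subrr subr0 normr0.
  rewrite !big_cons [_ *: _ + _]addrC addrA.
  set V := \sum_(i <- s) _ *: _ in IH *.
  have [xi xiv hxi] := line_MVT i (y + V) (v ord0 i).
  rewrite (_ : _ - _ - _ = v ord0 i * (partial i h (y + V + xi *: e_ i) -
    partial i h y) + (h (y + V) - h y - \sum_(i <- s) v ord0 i * partial i h y)).
    rewrite (le_trans (ler_normD _ _))// lerD//; last exact: IH.
    rewrite normrM -addrA.
    apply: (@le_trans _ _ (enorm v * (H * enorm v `^ b))).
      apply: ler_pM => //; first exact: coord_le_enorm.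
      apply: le_trans (hH _ _ _) _; rewrite ler_wpM2l// ge0_ler_powR//.
      - by rewrite nnegrE enorm_ge0.
      - by rewrite nnegrE enorm_ge0.
      apply: le_enorm => j; rewrite !mxE coord_partial_sum// eqxx/=.
      have [->|ji] := eqVneq j i; first by rewrite (negPf si) add0r mulr1.
      by rewrite mulr0 addr0; case: ifP; rewrite ?normr0.
    have [->|v0] := eqVneq (enorm v) 0; first by rewrite mul0r mulr_ge0 ?powR_ge0.
    rewrite powRD; last by rewrite v0 implybT.
    by rewrite powRr1 ?enorm_ge0// mulrCA [enorm v * _]mulrC.
  move/eqP : hxi; rewrite subr_eq => /eqP ->.
  by ring.
have := key _ (index_enum_uniq 'I_n).
rewrite -rV_decomp => /le_trans; apply.
by rewrite sumr_const card_ord -mulrA mulr_natl.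
Qed.

End holder_estimates.

Section holder_space.
Context {R : realType} {n : nat} (h : 'rV[R]_n -> R) (beta : R).
Hypotheses (n0 : (0 < n)%N) (b1 : 1 < beta) (b2 : beta < 2)
  (hh : holder_space beta h).

Let kE : Num.truncn beta = 1%N.
Proof. by apply: truncn_def; rewrite ltW. Qed.

(** The unit multi-indices. As [Num.truncn beta] is 1, multi-indices take values in ['I_2], into
    which [inord] casts the boolean. *)
Let gi (i : 'I_n) : {ffun 'I_n -> 'I_2} := [ffun j => inord (j == i)].
Let g0 : {ffun 'I_n -> 'I_2} := [ffun=> ord0].

Let giE i j : gi i j = (j == i) :> nat.
Proof. by rewrite ffunE inordK; case: eqP. Qed.

Let sum_gi i : (\sum_j gi i j)%N = 1%N.
Proof.
rewrite (bigD1 i)//= giE eqxx big1// => j ji.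
by rewrite giE (negPf ji).
Qed.

Let multi_partial_gi i : multi_partial (gi i) h = partial i h.
Proof.
rewrite /multi_partial.
have : uniq (enum 'I_n) by exact: enum_uniq.
have : i \in enum 'I_n by rewrite mem_enum.
elim: (enum _) => // j s IH; rewrite in_cons /= => + /andP[js us].
rewrite giE (eq_sym j i); have [ij _|ij /= si] := eqVneq i j; last exact: IH.
suff hE : foldr (fun k f => iter (gi i k) (partial k) f) h s = h.
  by rewrite -ij /= hE.
have {IH} : i \notin s by rewrite ij.
elim: s {js us} => //= k s IH; rewrite in_cons negb_or => /andP[ik si].
by rewrite giE eq_sym (negPf ik) /= IH.
Qed.

Let multi_partial_g0 : multi_partial g0 h = h.
Proof. by rewrite /multi_partial; elim: (enum _) => //= i s ->; rewrite ffunE. Qed.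

Let sup_norm_ge0 (f : 'rV[R]_n -> R) : (0 <= sup_norm f)%E.
Proof.
apply: (@le_trans _ _ `|f 0|%:E); first by rewrite lee_fin.
by apply: ereal_sup_ubound; exists 0.
Qed.

Let holder_normE : holder_norm beta h =
  (\sum_(g : {ffun 'I_n -> 'I_2} | (\sum_i g i <= 1)%N)
     sup_norm (multi_partial g h) + holder_seminorm beta h)%E.
Proof. by rewrite /holder_norm kE. Qed.

Let holder_seminormE : holder_seminorm beta h =
  ereal_sup [set r | exists (g : {ffun 'I_n -> 'I_2}) (x y : 'rV[R]_n),
    [/\ (\sum_i g i)%N = 1%N, y != 0 &
     r = (`|multi_partial g h (x + y) - multi_partial g h x| /
          enorm y `^ (beta - 1%:R))%:E]].
Proof. by rewrite /holder_seminorm kE. Qed.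

(** A supremum over the empty set would be minus infinity; [n0] provides a nonzero increment, so the
    set is inhabited by a nonnegative quotient. *)
Let holder_seminorm_ge0 : (0 <= holder_seminorm beta h)%E.
Proof.
rewrite holder_seminormE; pose i0 := Ordinal n0.
pose y : 'rV[R]_n := delta_mx ord0 i0.
have y0 : y != 0.
  apply/eqP => /rowP/(_ i0); rewrite !mxE !eqxx => /eqP.
  by rewrite oner_eq0.
apply: le_trans; last first.
  by apply: ereal_sup_ubound; exists (gi i0), 0, y; split; [exact: sum_gi|exact: y0|].
by rewrite lee_fin divr_ge0// powR_ge0.
Qed.

Lemma holder_norm_ge0 : (0 <= holder_norm beta h)%E.
Proof. by rewrite holder_normE adde_ge0// sume_ge0. Qed.

Lemma holder_norm_fin_num : holder_norm beta h \is a fin_num.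
Proof. by rewrite ge0_fin_numE ?holder_norm_ge0//; have [] := hh. Qed.

Let H := fine (holder_norm beta h).

Let H_ge0 : 0 <= H. Proof. by rewrite fine_ge0// holder_norm_ge0. Qed.

Let sup_norm_le (g : {ffun 'I_n -> 'I_2}) x : (\sum_i g i <= 1)%N ->
  `|multi_partial g h x| <= H.
Proof.
move=> g1; rewrite -lee_fin fineK ?holder_norm_fin_num// holder_normE.
rewrite (bigD1 g)//= -addeA; apply: le_trans (leeDl _ _); last first.
  by rewrite adde_ge0// sume_ge0.
by apply: ereal_sup_ubound; exists x.
Qed.

Lemma holder_bounded x : `|h x| <= H.
Proof.
rewrite -[X in `|X x|]multi_partial_g0; apply: sup_norm_le.
by rewrite big1// => i _; rewrite ffunE.
Qed.

Let partial_bounded i x : `|partial i h x| <= H.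
Proof. by rewrite -multi_partial_gi; apply: sup_norm_le; rewrite sum_gi. Qed.

Let partial_holder i x y :
  `|partial i h (x + y) - partial i h x| <= H * enorm y `^ (beta - 1).
Proof.
have [->|y0] := eqVneq y 0; first by rewrite addr0 subrr normr0 mulr_ge0 ?powR_ge0.
rewrite -ler_pdivrMr ?powR_gt0 ?enorm_gt0// -lee_fin fineK ?holder_norm_fin_num//.
rewrite holder_normE; apply: le_trans (leeDr _ _); last by rewrite sume_ge0.
rewrite holder_seminormE; apply: ereal_sup_ubound.
by exists (gi i), x, y; rewrite multi_partial_gi sum_gi.
Qed.

Let dh i x : derivable h x (delta_mx ord0 i).
Proof. by have [hp _] := hh; apply: (hp [::]); rewrite kE. Qed.

Lemma holder_lipschitz y v : `|h (y + v) - h y| <= H * \sum_i `|v ord0 i|.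
Proof. exact: lipschitz_of_partial. Qed.

Lemma measurable_holder : measurable_fun setT h.
Proof. exact: measurable_fun_lipschitz H_ge0 holder_lipschitz. Qed.

(** Pointwise limit of the difference quotients with steps 1/(k+1), each of them measurable because
    [h] is. *)
Let measurable_partial i : measurable_fun setT (partial i h).
Proof.
pose u k : R := k.+1%:R^-1.
apply: (@measurable_fun_cvg _ _ _ _
  (fun k y => (u k)^-1 * (h (u k *: delta_mx ord0 i + y) - h y))) => [k|y _].
  apply: measurable_funM; first exact: measurable_cst.
  apply: measurable_funB; last exact: measurable_holder.
  apply: (measurableT_comp measurable_holder).
  by apply: measurable_rVD; [exact: measurable_cst|exact: measurable_id].
pose q (c : R) : R := c^-1 * (h (c *: delta_mx ord0 i + y) - h y).
have qcvg : q c @[c --> 0^'] --> partial i h y by exact: (@dh i y).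
apply: ((cvgr_dnbhsP q 0 (partial i h y)).1 qcvg u); split; last exact: cvg_harmonic.
by move=> k; rewrite invr_eq0 pnatr_eq0.
Qed.

(** For the increment [c *: v] the linear term is [c] times the derivative along [v], and the
    remainder splits by homogeneity of [enorm]. *)
Lemma holder_taylor : taylor_bound h (n%:R * H) beta.
Proof.
move=> v; exists (fun y => \sum_i v ord0 i * partial i h y); split.
- by apply: measurable_sum => i; apply: measurable_funM.
- exists (\sum_i `|v ord0 i| * H) => y.
  apply: le_trans (ler_norm_sum _ _ _) _; apply: ler_sum => i _.
  by rewrite normrM ler_wpM2l.
- move=> y c; have b0 : 0 <= beta - 1 by rewrite subr_ge0 ltW.
  have := taylor_of_partial (@dh) H_ge0 b0 partial_holder y (c *: v).
  rewrite subrK enormZ powRM ?enorm_ge0// !mulrA; congr (`|_ - _| <= _).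
  by rewrite mulr_sumr; apply: eq_bigr => i _; rewrite mxE mulrA.
Qed.

End holder_space.

(** * The stable Levy measure near the origin *)

Section intensity.
Context {R : realType}.

Lemma measurable_neq0 n : measurable [set y : 'rV[R]_n | y != 0].
Proof.
rewrite (_ : mkset _ = ~` (\bigcap_i (fun y : 'rV[R]_n => y ord0 i) @^-1` [set 0])).
  apply: measurableC; apply: fin_bigcap_measurable => // i _.
  by rewrite -[X in measurable X]setTI; exact: measurable_coord.
apply/seteqP; split=> y /=.
  by move/eqP => y0 h; apply: y0; apply/rowP => i; rewrite mxE; exact: h.
by move=> h; apply/eqP => y0; apply: h => i _ /=; rewrite y0 mxE.
Qed.

Lemma measurable_enorm_itv n (i : interval R) :
  measurable [set y : 'rV[R]_n | enorm y \in i].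
Proof.
rewrite [X in measurable X](_ : _ = setT `&` enorm @^-1` [set` i]).
  exact: measurable_enorm.
by rewrite setTI.
Qed.

Definition shell n (a b : R) : set 'rV[R]_n := [set y | a < enorm y <= b].

Lemma measurable_shell n (a b : R) : measurable (@shell n a b).
Proof.
have := @measurable_enorm_itv n `]a, b].
by congr (measurable _); apply/seteqP; split=> y; rewrite /= in_itv.
Qed.

Definition cube n (r : R) : set 'rV[R]_n := [set y | forall i, `|y ord0 i| <= r].

Lemma measurable_cube n (r : R) : measurable (@cube n r).
Proof.
rewrite (_ : @cube n r =
    \bigcap_i (fun y : 'rV[R]_n => y ord0 i) @^-1` `[- r, r]%classic).
  apply: fin_bigcap_measurable => // i _; rewrite -[X in measurable X]setTI.
  exact: measurable_coord.
apply/seteqP; split=> y h i; first by rewrite /= in_itv/= -ler_norml.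
by have := h i I; rewrite /= in_itv/= -ler_norml.
Qed.

(** Cubes suit the recursive construction of [lebesgue_rV]: [rV_cons] pulls a cube back to an
    interval times a cube. A Euclidean ball of radius [r] lies in such a cube, which is all that the
    shells require. *)
Lemma lebesgue_rV_cube n (r : R) : 0 <= r ->
  (lebesgue_rV n (@cube n r) <= ((2 * r) ^+ n)%:E)%E.
Proof.
move=> r0; have lE : lebesgue_measure (`[- r, r]%classic : set R) = (2 * r)%:E.
  rewrite lebesgue_measure_itv/= lte_fin; case: ltP => rr; last by congr EFin; lra.
  by rewrite -EFinD; congr EFin; ring.
elim: n => [|n IH] /=.
  by rewrite expr0 diracE lee_fin; case: (_ \in _).
rewrite /lebesgue_rVS /pushforward [X in (_ X <= _)%E](_ : _ =
    `[- r, r]%classic `*` @cube n r).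
  rewrite product_measure1E//; last exact: measurable_cube.
  rewrite exprS EFinM -lE; apply: lee_pmul; [exact: measure_ge0..|exact: lexx|].
  exact: IH.
apply/seteqP; split=> -[a y] /=.
  move=> h; split; first by have := h ord0; rewrite mxE unlift_none/= in_itv/= -ler_norml.
  by move=> i; have := h (lift ord0 i); rewrite mxE liftK.
move=> [ha hy] i; rewrite mxE; case: unliftP => [j _|_] //=.
by move: ha; rewrite in_itv/= -ler_norml.
Qed.

Section stable.
Context (n : nat) (s : R) (s_gt0 : 0 < s) (T : R).
Local Notation nu := (@stable_nu R n s s_gt0).
Local Notation mu := (stable_intensity n s_gt0 T).

(** On the shell between r/2 and r the density is at most its value at radius r/2, and the volume is
    at most (2r)^n = 4^n (r/2)^n. The powers of order [n] cancel, and (r/2)^(-2s) leaves the factor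
    2^(2s). *)
Let shell_cst : R := stable_cst n s * (4 ^+ n * 2 `^ (2 * s)).

Let shell_cst_ge0 : 0 <= shell_cst.
Proof.
by rewrite mulr_ge0 ?stable_cst_ge0// mulr_ge0 ?powR_ge0.
Qed.

Lemma stable_nu_shell (r : R) : 0 < r ->
  (nu (@shell n (r / 2) r) <= (shell_cst * r `^ (- (2 * s)))%:E)%E.
Proof.
move=> r0; rewrite /= /stable_nu.
set A := _ `&` _.
have mA : measurable A.
  apply: measurableI; last exact: measurable_neq0.
  exact: measurable_shell.
pose M := stable_cst n s * (r / 2) `^ (- n%:R - 2 * s).
have M0 : 0 <= M by rewrite mulr_ge0 ?powR_ge0// stable_cst_ge0.
have md : measurable_fun setT (@stable_density R n s).
  apply: measurable_funM => //; apply: (measurableT_comp (measurable_powR _)).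
  exact: measurable_enorm.
apply: (@le_trans _ _ (\int[lebesgue_rV n]_(y in A) (cst M%:E) y)%E).
  apply: ge0_le_integral => //.
  - by move=> y _; rewrite lee_fin mulr_ge0 ?powR_ge0 ?stable_cst_ge0.
  - by apply/measurable_EFinP; exact: measurable_funTS.
  - move=> y [/andP[ry _] _]; rewrite lee_fin ler_wpM2l ?stable_cst_ge0//.
    rewrite -opprD !powRN lef_pV2 ?posrE ?powR_gt0 ?divr_gt0//; last first.
      by rewrite (lt_trans _ ry)// divr_gt0.
    rewrite ge0_ler_powR ?nnegrE ?enorm_ge0 ?divr_ge0 ?ltW//.
    by rewrite ltr_wpDl// mulr_gt0.
rewrite integral_cst//.
apply: (@le_trans _ _ (M%:E * ((2 * r) ^+ n)%:E)%E).
  apply: lee_wpmul2l => //; apply: le_trans (lebesgue_rV_cube n (ltW r0)).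
  apply: le_measure; [exact: (mem_set mA)|exact: (mem_set (@measurable_cube n r))|].
  by move=> y [/andP[_ yr] _] i; rewrite (le_trans (coord_le_enorm _ _)).
rewrite -EFinM lee_fin /M /shell_cst -[leLHS]mulrA -[leRHS]mulrA.
rewrite ler_wpM2l ?stable_cst_ge0// le_eqVlt; apply/orP; left; apply/eqP.
have r2 : 0 < r / 2 by rewrite divr_gt0.
rewrite powRD; last by rewrite (gt_eqF r2) implybT.
rewrite !powRN !powR_mulrn ?(ltW r2)//.
have e2 : 2^-1 `^ (2 * s) = (2 `^ (2 * s))^-1 :> R.
  by rewrite -powR_inv1// -powRrM mulN1r powRN.
rewrite (powRM _ (ltW r0)) ?invr_ge0// e2.
have a0 : 2 `^ (2 * s) != 0 :> R by rewrite gt_eqF// powR_gt0.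
have b0 : r `^ (2 * s) != 0 :> R by rewrite gt_eqF// powR_gt0.
rewrite (_ : (2 * r) ^+ n = 4 ^+ n * (r / 2) ^+ n); last first.
  by rewrite -exprMn; congr (_ ^+ n); field.
have c0 : (r / 2) ^+ n != 0 by rewrite expf_neq0// gt_eqF.
by move: ((r / 2) ^+ n) c0 => c c0; field; rewrite a0 b0 c0.
Qed.

Definition small_ball (r : R) : set 'rV[R]_n := [set y | y != 0 /\ enorm y <= r].

Lemma measurable_small_ball r : measurable (small_ball r).
Proof.
rewrite (_ : small_ball r = [set y | y != 0] `&` [set y | enorm y \in `]-oo, r]]).
  apply: measurableI; first exact: measurable_neq0.
  exact: measurable_enorm_itv.
by apply/seteqP; split=> y; rewrite /= in_itv.
Qed.

(* Dyadic shells: bounding the integrand and the volume on each of them needs no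
   change of variables for [lebesgue_rV]. *)
Let rad (r : R) k : R := r / 2 ^+ k.

Let rad_gt0 r k : 0 < r -> 0 < rad r k.
Proof. by move=> r0; rewrite divr_gt0// exprn_gt0. Qed.

Let radS r k : rad r k.+1 = rad r k / 2.
Proof. by rewrite /rad exprS invfM; ring. Qed.

Let rad_le r k m : 0 < r -> (k <= m)%N -> rad r m <= rad r k.
Proof.
by move=> r0 km; rewrite ler_wpM2l ?(ltW r0)// lef_pV2 ?posrE ?exprn_gt0// ler_weXn2l// ler1n.
Qed.

Let small_ballE r : 0 < r ->
  small_ball r = \bigcup_k @shell n (rad r k.+1) (rad r k).
Proof.
move=> r0; apply/seteqP; split=> [y [y0 yr]|y [k _ /andP[ry yr]]]; last first.
  split; last by rewrite (le_trans yr)// (le_trans (rad_le r0 (leq0n k)))// /rad expr0 divr1.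
  apply: contraTneq ry => ->; rewrite -leNgt /enorm big1 ?sqrtr0 ?ltW ?rad_gt0//.
  by move=> i _; rewrite mxE expr0n.
have ey := enorm_gt0 y0.
have ex : exists k, rad r k < enorm y.
  have : (fun k => rad r k) @ \oo --> (0 : R).
    rewrite -(mulr0 r); apply: cvgMr; under eq_fun do rewrite -exprVn.
    by apply: cvg_expr; rewrite ger0_norm ?invf_lt1// ltr1n.
  move=> /cvgrPdist_lt/(_ _ ey)[k _ /(_ _ (leqnn k))] /=.
  by rewrite sub0r normrN gtr0_norm ?rad_gt0// => ?; exists k.
(* The least index whose radius is below |y| is not 0, because [rad r 0 = r]; by minimality the
   preceding radius is still at least |y|. *)
case: (ex_minnP ex) => -[|k] ky kmin.
  by move: ky; rewrite /rad expr0 divr1 ltNge yr.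
exists k => //; apply/andP; split=> //; rewrite leNgt; apply/negP => /kmin.
by rewrite ltnn.
Qed.

Let trivIset_shell r : 0 < r ->
  trivIset setT (fun k => @shell n (rad r k.+1) (rad r k)).
Proof.
move=> r0.
have lt_disj k m : (k < m)%N ->
    @shell n (rad r k.+1) (rad r k) `&` @shell n (rad r m.+1) (rad r m) = set0.
  move=> km; rewrite -subset0 => y [/andP[ky _] /andP[_ ym]].
  by have := le_trans ym (rad_le r0 km); rewrite leNgt ky.
apply/trivIsetP => k m _ _; rewrite neq_ltn => /orP[|]; first exact: lt_disj.
by move=> mk; rewrite setIC lt_disj.
Qed.

Lemma stable_intensityX t (B : set 'rV[R]_n) : 0 <= t <= T -> measurable B ->
  mu (`]0, t]%classic `*` B) = (t%:E * nu B)%E.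
Proof.
move=> /andP[t0 tT] mB; rewrite /stable_intensity /= product_measure1E//.
congr (_ * _)%E.
suff : lebesgue_measure (`]0, t]%classic `&` `[0, T]%classic : set R) = t%:E by [].
rewrite setIidl; last first.
  move=> x; rewrite /= !in_itv/= => /andP[x0 xt].
  by rewrite ltW//= (le_trans xt).
rewrite lebesgue_measure_itv/= lte_fin; case: ltP => tt.
  by rewrite -EFinD subr0.
by congr EFin; apply/eqP; rewrite eq_le t0 tt.
Qed.

(** Sum of a geometric series over the dyadic shells; its ratio 2^(2s - p) is below 1 exactly when p
    > 2s. *)
Definition power_cst (p : R) : R := shell_cst / (1 - 2 `^ (2 * s - p)).

(** On the shell of outer radius rho = r / 2^k the integrand is at most rho^p and the intensity at
    most t times [shell_cst] times rho^(-2s). The lemma serves twice: with exponent [beta] and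
    radius [eps] for the rate, and with exponent 2 and radius 1 for square integrability. *)
Lemma integral_small_ball_power (p r t : R) : 2 * s < p -> 0 < r ->
  0 <= t <= T ->
  (\int[mu]_(z in `]0%R, t]%classic `*` small_ball r) (enorm z.2 `^ p)%:E <=
   (t * (power_cst p * r `^ (p - 2 * s)))%:E)%E.
Proof.
move=> sp r0 tT; have /andP[t0 _] := tT.
have p0 : 0 <= p by rewrite ltW// (lt_trans _ sp)// mulr_gt0.
pose F k := `]0%R, t]%classic `*` @shell n (rad r k.+1) (rad r k).
have mF k : measurable (F k) by apply: measurableX => //; exact: measurable_shell.
have tF : trivIset setT F.
  apply/trivIsetP => k m _ _ km; rewrite -subset0 => z [[_ zk] [_ zm]].
  by have := (trivIsetP.1 (trivIset_shell r0)) k m I I km; rewrite -subset0 => /(_ z.2); apply.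
have -> : `]0%R, t]%classic `*` small_ball r = \bigcup_k F k.
  rewrite small_ballE//; apply/seteqP; split=> z /=.
    by move=> [zt [k _ zk]]; exists k.
  by move=> [k _ [zt zk]]; split => //; exists k.
have mf : measurable_fun setT
    (fun z : measurableTypeR R * 'rV[R]_n => (enorm z.2 `^ p)%:E).
  apply/measurable_EFinP; apply: (measurableT_comp (measurable_powR _)).
  exact: (measurableT_comp measurable_enorm measurable_snd).
rewrite ge0_integral_bigcup//; last 2 first.
- exact: measurable_funTS.
- by move=> z _; rewrite lee_fin powR_ge0.
pose q : R := 2 `^ (2 * s - p).
have q0 : 0 < q by rewrite powR_gt0.
have q1 : q < 1.
  have sp0 : 2 * s - p < 0 by rewrite subr_lt0.
  by rewrite /q /powR pnatr_eq0/= -[ltRHS]expR0 ltr_expR nmulr_rlt0// ln_gt0// ltr1n.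
pose a : R := t * (shell_cst * r `^ (p - 2 * s)).
have a0 : 0 <= a by rewrite mulr_ge0// mulr_ge0// powR_ge0.
apply: (@le_trans _ _ (\sum_(k <oo) (geometric a q k)%:E)%E).
  apply: lee_nneseries => [k _ _|k _].
    by apply: integral_ge0 => z _; rewrite lee_fin powR_ge0.
  apply: (@le_trans _ _ (\int[mu]_(z in F k) (cst (rad r k `^ p)%:E) z)%E).
    apply: ge0_le_integral => //.
    - exact: mF.
    - by move=> z _; rewrite lee_fin powR_ge0.
    - exact: measurable_funTS.
    - move=> z [_ /andP[_ zr]]; rewrite lee_fin ge0_ler_powR// nnegrE ?enorm_ge0//.
      exact/ltW/rad_gt0.
  rewrite integral_cst; last exact: mF.
  rewrite stable_intensityX//; last exact: measurable_shell.
  have k0 := rad_gt0 k r0.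
  apply: (@le_trans _ _ ((rad r k `^ p)%:E *
      (t%:E * (shell_cst * rad r k `^ (- (2 * s)))%:E))%E).
    apply: lee_wpmul2l; first by rewrite lee_fin powR_ge0.
    by apply: lee_wpmul2l; rewrite ?lee_fin// radS; exact: stable_nu_shell.
  rewrite -!EFinM lee_fin /geometric /a /=.
  have -> : rad r k `^ p * (t * (shell_cst * rad r k `^ (- (2 * s)))) =
      t * (shell_cst * rad r k `^ (p - 2 * s)).
    rewrite powRD; first by ring.
    by rewrite (gt_eqF k0) implybT.
  have -> : t * (shell_cst * r `^ (p - 2 * s)) * q ^+ k =
      t * (shell_cst * (r `^ (p - 2 * s) * q ^+ k)) by ring.
  apply: ler_wpM2l => //; apply: ler_wpM2l => //.
  rewrite /rad powRM ?(ltW r0)// ?invr_ge0 ?exprn_ge0//.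
  rewrite ler_wpM2l ?powR_ge0// /q -powR_mulrn ?powR_ge0// -powRrM.
  rewrite -powR_inv1 ?exprn_ge0// -powR_mulrn// -!powRrM.
  by rewrite le_eqVlt; apply/orP; left; apply/eqP; congr (_ `^ _); ring.
apply: lime_le.
  by apply: is_cvg_nneseries => k _ _; rewrite lee_fin mulr_ge0// exprn_ge0// ltW.
apply: nearW => m; rewrite sumEFin lee_fin.
have -> : t * (power_cst p * r `^ (p - 2 * s)) = a / (1 - q).
  by rewrite /power_cst /a -/q; ring.
by have := geometric_le_lim m a0 q0; apply; rewrite gtr0_norm.
Qed.

End stable.
End intensity.

(** * Simple functions and the isometry *)

Section level_sets.
Context {R : realType} d' (E : measurableType d').
Context (J : eqType) (kappa : E -> J) (j0 : J) (D : set E) (s : seq J).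
Hypotheses (mD : measurable D) (us : uniq s) (kappas : forall z, kappa z \in s)
  (mkappa : forall j, measurable (kappa @^-1` [set j])).

(* The level set of the value [j0], in practice zero, is replaced by the empty set
   because it may have infinite measure. *)
Definition level (j : J) : set E :=
  if j == j0 then set0 else D `&` kappa @^-1` [set j].

Lemma measurable_level j : measurable (level j).
Proof. by rewrite /level; case: ifP => _ //; exact: measurableI. Qed.

Lemma level_sub j : level j `<=` D.
Proof. by rewrite /level; case: ifP => // _ z []. Qed.

Lemma level_disjoint i j : i != j -> level i `&` level j = set0.
Proof.
rewrite /level; do 2 case: ifP => _; rewrite ?set0I ?setI0// => ij.
by rewrite -subset0 => z [[_ /= zi] [_ /= zj]]; move: ij; rewrite -zi -zj eqxx.
Qed.

Lemma level_notin j : j \notin s -> level j = set0.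
Proof.
move=> js; rewrite /level; case: ifP => // _; rewrite -subset0 => z [_ /= zj].
by move: js; rewrite -zj kappas.
Qed.

Lemma level_decomp (c : J -> R) : c j0 = 0 -> forall z, D z ->
  c (kappa z) = \sum_(j <- s) c j * \1_(level j) z.
Proof.
move=> c0 z Dz; rewrite (bigD1_seq (kappa z))//= big1 ?addr0.
  rewrite /level; case: eqP => [->|_]; first by rewrite c0 mul0r.
  by rewrite indicE mem_set// mulr1.
move=> j jz; rewrite indicE memNset ?mulr0//.
rewrite /level; case: ifP => _; first by [].
by move=> [_ /= zj]; rewrite zj eqxx in jz.
Qed.

(** Stated for any measure and any [c] vanishing at [j0], as it is applied to [mu] and to [N w]
    alike, with [c] the identity, the square, a coordinate of a vector, or a power of its norm. *)
Lemma integrable_level (m : {measure set E -> \bar R}) (c : J -> R) :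
  (forall j, (m (level j) < +oo)%E) -> c j0 = 0 ->
  m.-integrable D (EFin \o (c \o kappa)) /\
  \int[m]_(z in D) c (kappa z) = \sum_(j <- s) c j * fine (m (level j)).
Proof.
move=> finm c0.
have mE j : (\int[m]_(z in D) (\1_(level j) z)%:E = m (level j))%E.
  rewrite integral_indic//; last exact: measurable_level.
  by rewrite setIidl//; exact: level_sub.
have i1 j : m.-integrable D (EFin \o \1_(level j)).
  apply/integrableP; split.
    by apply/measurable_EFinP/measurable_indic; exact: measurable_level.
  rewrite (eq_integral (fun z => (\1_(level j) z)%:E)) ?mE// => z _.
  by rewrite abse_EFin ger0_norm // indicE ler0n.
have ic j : m.-integrable D (fun z => (c j)%:E * (\1_(level j) z)%:E)%E.
  exact: (integrableZl mD (c j) (i1 j)).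
have isum : m.-integrable D
    (fun z => \sum_(j <- s) ((c j)%:E * (\1_(level j) z)%:E))%E.
  by apply: (integrable_sum mD).
have cE : {in D, (fun z => \sum_(j <- s) ((c j)%:E * (\1_(level j) z)%:E))%E =1
    EFin \o (c \o kappa)}.
  move=> z /set_mem zD; rewrite /= (level_decomp c0 zD) -sumEFin.
  by apply: eq_bigr => j _; rewrite EFinM.
split; first by apply: (eq_integrable mD _ _ cE isum).
rewrite /Rintegral -(eq_integral _ _ cE) integral_sum//.
rewrite -[RHS]/(fine (\sum_(j <- s) c j * fine (m (level j)))%:E) -sumEFin.
congr fine; apply: eq_bigr => j _; rewrite (integralZl mD (i1 j)) [X in (_ * X)%E]mE.
by rewrite EFinM fineK// ge0_fin_numE.
Qed.

End level_sets.

Lemma filter_seq (T : Type) (F : set_system T) {FF : Filter F} (J : eqType)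
    (s : seq J) (Q : J -> T -> Prop) :
  (forall j, \forall w \near F, Q j w) ->
  \forall w \near F, forall j, j \in s -> Q j w.
Proof.
move=> h; elim: s => [|i s IH]; first by apply: filterE => w j.
apply: filterS2 (h i) IH => w Qi Qs j.
rewrite in_cons => /orP[/eqP ->//|].
exact: Qs.
Qed.

Section compensated_integral.
Context {R : realType} d (Omega : measurableType d) (P : probability Omega R).
Context d' (E : measurableType d') (N : R.-ker Omega ~> E)
  (mu : {measure set E -> \bar R}).
Hypothesis pN : poisson_random_measure P N mu.
Local Notation cN := (compensated N mu).

Definition compensated_int (D : set E) (g : E -> R) (w : Omega) : R :=
  \int[N w]_(z in D) g z - \int[mu]_(z in D) g z.

Lemma adapted_compensated_int (D C : set E) (g : E -> R) : measurable D ->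
  D `<=` C -> measurable_fun setT g -> adapted N C (compensated_int D g).
Proof.
move=> mD DC mg; apply: measurable_funB; last exact: measurable_cst.
exact: adapted_Rintegral.
Qed.

Lemma measurable_compensated_int (D : set E) (g : E -> R) : measurable D ->
  measurable_fun setT g -> measurable_fun setT (compensated_int D g).
Proof.
by move=> mD mg; exact: adapted_measurable (adapted_compensated_int mD (@subset_refl _ D) mg).
Qed.

Section level.
Context (J : eqType) (kappa : E -> J) (j0 : J) (D : set E) (s : seq J).
Hypotheses (mD : measurable D) (us : uniq s) (kappas : forall z, kappa z \in s)
  (mkappa : forall j, measurable (kappa @^-1` [set j]))
  (finmu : forall j, (mu (level kappa j0 D j) < +oo)%E).

(** The exceptional set, where some level has infinite mass under [N w], does not depend on [c]; so
    one null set serves all coordinates of a vector-valued [kappa]. *)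
Lemma ae_compensated_int_level : {ae P, forall w, forall c : J -> R, c j0 = 0 ->
  (N w).-integrable D (EFin \o (c \o kappa)) /\
  compensated_int D (c \o kappa) w =
  \sum_(j <- s) c j * cN (level kappa j0 D j) w}.
Proof.
have finN : {ae P, forall w, forall j, j \in s ->
    N w (level kappa j0 D j) \is a fin_num}.
  apply: filter_seq => j; apply: (ae_fin_num_kernel pN) => //.
  exact: measurable_level.
apply: filterS finN => w hw c c0.
have finw j : (N w (level kappa j0 D j) < +oo)%E.
  have [js|js] := boolP (j \in s); first by rewrite ltey_eq hw.
  by rewrite (level_notin j0 D kappas)// measure0.
have [ic cE] := integrable_level mD us kappas mkappa finw c0.
split => //; have [_ muE] := integrable_level mD us kappas mkappa finmu c0.
rewrite /compensated_int cE muE -sumrB.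
by apply: eq_bigr => j _; rewrite /compensated mulrBr.
Qed.

End level.

Section simple.
Context (D : set E) (mD : measurable D).

(** For simple functions this amounts to integrability on [D], in a form that Chebyshev's inequality
    yields directly. *)
Definition finite_levels (g : E -> R) :=
  forall x, (mu (level g 0%R D x) < +oo)%E.

Let s (g : {sfun E >-> R}) : seq R := finmap.enum_fset (fset_set (range g)).
Let us g : uniq (s g). Proof. exact: finmap.fset_uniq. Qed.
Let gs (g : {sfun E >-> R}) z : g z \in s g.
Proof.
have := in_fset_set (@fimfunP _ _ g) (g z).
by rewrite (mem_set (_ : range g (g z))) => [->|]; last by exists z.
Qed.
Let mg (g : {sfun E >-> R}) x : measurable (g @^-1` [set x]).
Proof. exact: measurable_sfunP. Qed.

Lemma finite_levelsP (g : {sfun E >-> R}) :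
  mu.-integrable D (EFin \o g) -> finite_levels g.
Proof.
move=> ig x; have [->|x0] := eqVneq x 0; first by rewrite /level eqxx measure0.
have mL := measurable_level (0 : R) mD (mg g) x.
move/integrableP : (ig) => [mfg gfin].
have h : (`|x|%:E * mu (level g 0%R D x) < +oo)%E.
  apply: le_lt_trans gfin; rewrite -integral_cst//.
  apply: (@le_trans _ _ (\int[mu]_(z in level g 0%R D x) `|(EFin \o g) z|)%E).
    apply: ge0_le_integral => //.
    - by move=> z _; rewrite lee_fin.
    - apply: measurableT_comp => //; apply: measurable_funS mfg => //.
      exact: level_sub.
    - by move=> z; rewrite /level (negPf x0) => -[_ /= ->].
  apply: ge0_subset_integral => //; first exact: measurableT_comp.
  exact: level_sub.
by move: h; apply: contraTT; rewrite -!leNgt !leye_eq => /eqP ->;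
  rewrite gt0_muley// lte_fin normr_gt0.
Qed.

Lemma integrable_finite_levels (g : {sfun E >-> R}) : finite_levels g ->
  mu.-integrable D (EFin \o g).
Proof.
by move=> fg; have [] := @integrable_level _ _ _ _ g 0 D (s g) mD (us g) (gs g)
  (mg g) mu id fg erefl.
Qed.

(** The Ito isometry on simple functions: almost surely the integral is a finite sum over levels,
    where [compensated_sum_isometry] applies. *)
Lemma compensated_int_isometry (g : {sfun E >-> R}) : finite_levels g ->
  (\int[P]_w (compensated_int D g w ^+ 2)%:E =
   \int[mu]_(z in D) (g z ^+ 2)%:E)%E.
Proof.
move=> fg.
have aeE := @ae_compensated_int_level _ g 0 D (s g) mD (us g) (gs g) (mg g) fg.
have [iS ES] := @compensated_sum_isometry _ _ _ P _ _ N mu pN _ (level g 0%R D)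
  (measurable_level (0 : R) mD (mg g)) fg (s g) id (us g)
  (fun i j _ _ => @level_disjoint _ _ _ g 0 D i j).
have [ig2 Eg2] := @integrable_level _ _ _ _ g 0 D (s g) mD (us g) (gs g)
  (mg g) mu (fun x => x ^+ 2) fg (expr0n _ _).
transitivity (\int[P]_w ((\sum_(x <- s g) x * cN (level g 0%R D x) w) ^+ 2)%:E)%E.
  apply: ae_eq_integral => //.
  - apply/measurable_EFinP; apply: measurable_funX.
    exact: measurable_compensated_int.
  - by have /measurable_int := iS.
  - apply: filterS aeE => w /(_ id erefl)[_] /= cE _.
    by rewrite -cE.
have <- := fineK (integrable_fin_num measurableT iS).
have <- := fineK (integrable_fin_num mD ig2).
by rewrite -[fine _]/(Rintegral _ _ _) -[in RHS]/(Rintegral _ _ _) ES -Eg2.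
Qed.

Lemma ae_integrable_kernel (g : {sfun E >-> R}) : finite_levels g ->
  {ae P, forall w, (N w).-integrable D (EFin \o g)}.
Proof.
move=> fg.
have aeE := @ae_compensated_int_level _ g 0 D (s g) mD (us g) (gs g) (mg g) fg.
by apply: filterS aeE => w /(_ id erefl)[].
Qed.

End simple.

End compensated_integral.

(** * Approximation in mean square *)

Section L2_approximation.
Import HBNNSimple.
Context {R : realType} d' (E : measurableType d').

(** Difference of the monotone approximations of the positive and negative parts. The domination by
    [f] matters as much as the convergence: it gives finite levels, an integrable majorant, and
    later the comparison of jump sizes. *)
Lemma sfun_approximation (f : E -> R) : measurable_fun setT f ->
  exists g : nat -> {sfun E >-> R},
    (forall k z, `|g k z| <= `|f z|) /\ (forall z, g ^~ z @ \oo --> f z).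
Proof.
move=> mf; pose fp z := Num.max (f z) 0; pose fn z := Num.max (- f z) 0.
have mfp : measurable_fun setT (EFin \o fp).
  by apply/measurable_EFinP; exact: measurable_maxr.
have mfn : measurable_fun setT (EFin \o fn).
  by apply/measurable_EFinP; apply: measurable_maxr => //; exact: measurable_funN.
have fp0 z : setT z -> (0 <= (EFin \o fp) z)%E by rewrite lee_fin le_max lexx orbT.
have fn0 z : setT z -> (0 <= (EFin \o fn) z)%E by rewrite lee_fin le_max lexx orbT.
pose gp := nnsfun_approx measurableT mfp; pose gn := nnsfun_approx measurableT mfn.
have gpl k z : 0 <= gp k z <= fp z.
  by rewrite fun_ge0/= nnsfun_approxE -lee_fin (@le_approx _ _ _ _ _ k z fp0 I).
have gnl k z : 0 <= gn k z <= fn z.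
  by rewrite fun_ge0/= nnsfun_approxE -lee_fin (@le_approx _ _ _ _ _ k z fn0 I).
exists (fun k => (gp k : {sfun E >-> R}) - (gn k : {sfun E >-> R})); split.
  move=> k z; have := gpl k z; have := gnl k z.
  have [_ ->] := max0_split (f z); rewrite -/(fp z) -/(fn z) sfunB /= ler_norml.
  by lra.
move=> z; have [-> _] := max0_split (f z); rewrite -/(fp z) -/(fn z).
have cp : (fun k => gp k z) @ \oo --> fp z.
  exact: (fine_cvg (cvg_nnsfun_approx measurableT mfp fp0 (I : setT z))).
have cn : (fun k => gn k z) @ \oo --> fn z.
  exact: (fine_cvg (cvg_nnsfun_approx measurableT mfn fn0 (I : setT z))).
exact: (cvgB cp cn).
Qed.

Context (mu : {measure set E -> \bar R}) (D : set E) (mD : measurable D).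

(** From (a + b)^2 <= 2 a^2 + 2 b^2; in this form the integrals may be infinite. *)
Lemma integral_sqr_triangle (f g h : E -> R) : measurable_fun setT f ->
  measurable_fun setT g -> measurable_fun setT h ->
  (\int[mu]_(z in D) ((f z - h z) ^+ 2)%:E <=
   2%:E * \int[mu]_(z in D) ((f z - g z) ^+ 2)%:E +
   2%:E * \int[mu]_(z in D) ((g z - h z) ^+ 2)%:E)%E.
Proof.
move=> mf mg mh.
have m2 (u v : E -> R) : measurable_fun setT u -> measurable_fun setT v ->
    measurable_fun D (fun z => ((u z - v z) ^+ 2)%:E).
  move=> mu_ mv; apply: measurable_funTS; apply/measurable_EFinP.
  by apply: measurable_funX; exact: measurable_funB.
rewrite -!ge0_integralZl//; try (exact: m2); try by move=> z _; rewrite lee_fin sqr_ge0.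
rewrite -ge0_integralD//; last 4 first.
- by move=> z _; rewrite -EFinM lee_fin mulr_ge0// sqr_ge0.
- by apply: measurable_funeM; exact: m2.
- by move=> z _; rewrite -EFinM lee_fin mulr_ge0// sqr_ge0.
- by apply: measurable_funeM; exact: m2.
apply: ge0_le_integral => //.
- by move=> z _; rewrite lee_fin sqr_ge0.
- exact: m2.
- by apply: emeasurable_funD; apply: measurable_funeM; exact: m2.
move=> z _; rewrite -!EFinM -EFinD lee_fin.
by have := sqr_ge0 ((f z - g z) - (g z - h z)); nra.
Qed.

Lemma cvg_sqr_integral (f : E -> R) (g : nat -> {sfun E >-> R}) :
  measurable_fun setT f ->
  (forall k z, `|g k z| <= `|f z|) -> (forall z, g ^~ z @ \oo --> f z) ->
  (\int[mu]_(z in D) (f z ^+ 2)%:E < +oo)%E ->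
  (\int[mu]_(z in D) ((g k z - f z) ^+ 2)%:E @[k --> \oo] --> 0)%E.
Proof.
move=> mf gf cg f2.
have if2 : mu.-integrable D (EFin \o (fun z => f z ^+ 2)).
  apply/integrableP; split.
    by apply/measurable_EFinP; apply: measurable_funTS; exact: measurable_funX.
  apply: le_lt_trans f2; rewrite le_eqVlt; apply/orP; left; apply/eqP.
  by apply: eq_integral => z _; rewrite abse_EFin ger0_norm// sqr_ge0.
have m1 k : measurable_fun D (fun z => ((g k z - f z) ^+ 2)%:E).
  apply/measurable_EFinP; apply: measurable_funTS.
  by apply: measurable_funX; exact: measurable_funB.
have m0 : measurable_fun D (cst 0%E : E -> \bar R) by exact: measurable_cst.
have c1 : {ae mu, forall z, D z ->
    (fun k => ((g k z - f z) ^+ 2)%:E) @ \oo --> (cst 0%E : E -> \bar R) z}.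
  apply: filterE => z _; apply: cvg_EFin; first exact: nearW.
  have cB : g k z - f z @[k --> \oo] --> (0 : R).
    by rewrite -(subrr (f z)); apply: cvgB; [exact: cg|exact: cvg_cst].
  by have h := cvgM cB cB; rewrite mulr0 in h; exact: h.
(* The majorant comes from |g - f| <= 2 |f|. *)
have d1 : {ae mu, forall z, forall k, D z ->
    (`|((g k z - f z) ^+ 2)%:E| <= 4%:E * (f z ^+ 2)%:E)%E}.
  apply: filterE => z k _; rewrite abse_EFin -EFinM lee_fin ger0_norm ?sqr_ge0//.
  rewrite -(real_normK (num_real (g k z - f z))) -(real_normK (num_real (f z))).
  have : `|g k z - f z| <= 2 * `|f z|.
    by rewrite (le_trans (ler_normB _ _))//; have := gf k z; lra.
  by have := normr_ge0 (g k z - f z); have := normr_ge0 (f z); nra.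
have [_ _] := dominated_convergence mD m1 m0 c1 (integrableZl mD 4 if2) d1.
by rewrite integral0.
Qed.

(** Chebyshev's inequality in L^2: on the level of a value [x != 0] one has x^2 <= f^2. *)
Lemma finite_levels_sqr (f : E -> R) (g : {sfun E >-> R}) :
  measurable_fun setT f -> (forall z, `|g z| <= `|f z|) ->
  (\int[mu]_(z in D) (f z ^+ 2)%:E < +oo)%E -> finite_levels mu D g.
Proof.
move=> mf gf f2 x; have [->|x0] := eqVneq x 0; first by rewrite /level eqxx measure0.
have mL : measurable (level g 0 D x).
  by apply: measurable_level => // y; exact: measurable_sfunP.
have h : ((x ^+ 2)%:E * mu (level g 0%R D x) < +oo)%E.
  apply: le_lt_trans f2; rewrite -integral_cst//.
  have mf2 : measurable_fun D (fun z => (f z ^+ 2)%:E).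
    by apply/measurable_EFinP; apply: measurable_funTS; exact: measurable_funX.
  apply: (@le_trans _ _ (\int[mu]_(z in level g 0%R D x) (f z ^+ 2)%:E)%E).
    apply: ge0_le_integral => //.
    - by move=> z _; rewrite lee_fin sqr_ge0.
    - by apply: measurable_funS mf2 => //; exact: level_sub.
    - move=> z; rewrite /level (negPf x0) => -[_ /= <-]; rewrite lee_fin.
      rewrite -real_normK ?num_real// -[leRHS]real_normK ?num_real//.
      by rewrite lerXn2r// nnegrE.
  apply: ge0_subset_integral => //; last exact: level_sub.
  by move=> z _; rewrite lee_fin sqr_ge0.
by move: h; apply: contraTT; rewrite -!leNgt !leye_eq => /eqP ->;
  rewrite gt0_muley// lte_fin exprn_even_gt0.
Qed.

End L2_approximation.

Section compensated_integral_unique.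
Context {R : realType} d (Omega : measurableType d) (P : probability Omega R).
Context d' (E : measurableType d') (N : R.-ker Omega ~> E)
  (mu : {measure set E -> \bar R}).
Hypothesis pN : poisson_random_measure P N mu.
Context (D : set E) (mD : measurable D).

Lemma ae_compensated_intB (g h : {sfun E >-> R}) :
  finite_levels mu D g -> finite_levels mu D h ->
  {ae P, forall w, compensated_int N mu D g w - compensated_int N mu D h w =
    compensated_int N mu D (g - h) w}.
Proof.
move=> fg fh.
have ig := integrable_finite_levels mD fg; have ih := integrable_finite_levels mD fh.
apply: filterS2 (ae_integrable_kernel pN mD fg) (ae_integrable_kernel pN mD fh).
move=> w igw ihw; rewrite /compensated_int.
have RB (m : {measure set E -> \bar R}) : m.-integrable D (EFin \o g) ->
    m.-integrable D (EFin \o h) -> \int[m]_(z in D) (g - h) z =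
    \int[m]_(z in D) g z - \int[m]_(z in D) h z.
  by move=> img imh; rewrite -RintegralB.
by rewrite !RB//; ring.
Qed.

(** The hypothesis on [X] yields convergence along some sequence [g'] only. By the isometry the
    integrals of [g'] and [g] are as close in L^2(P) as the functions are in L^2(mu), where both
    tend to [f]. Hence the approximating sequence may be chosen freely, in particular the same for
    different domains. *)
Lemma compensated_integral_cvg (f : E -> R) (X : Omega -> R)
    (g : nat -> {sfun E >-> R}) : measurable_fun setT f ->
  compensated_integral P N mu D f X ->
  (forall k, finite_levels mu D (g k)) ->
  (\int[mu]_(z in D) ((g k z - f z) ^+ 2)%:E @[k --> \oo] --> 0)%E ->
  (\int[P]_w ((X w - compensated_int N mu D (g k) w) ^+ 2)%:E @[k --> \oo]
    --> 0)%E.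
Proof.
move=> mf [mX [g' [ig' g'f g'X]]] fg gf.
have fg' k := finite_levelsP mD (ig' k).
have mc (u : {sfun E >-> R}) : measurable_fun setT (compensated_int N mu D u).
  exact: measurable_compensated_int.
have diff k : (\int[P]_w ((compensated_int N mu D (g' k) w -
      compensated_int N mu D (g k) w) ^+ 2)%:E =
    \int[mu]_(z in D) ((g' k z - g k z) ^+ 2)%:E)%E.
  have fB : finite_levels mu D (g' k - g k).
    apply: finite_levelsP => //.
    exact: (integrableB mD (ig' k) (integrable_finite_levels mD (fg k))).
  rewrite -(compensated_int_isometry pN mD fB).
  apply: ae_eq_integral => //.
  - apply/measurable_EFinP; apply: measurable_funX.
    by apply: measurable_funB; exact: mc.
  - by apply/measurable_EFinP; apply: measurable_funX; exact: mc.
  - apply: filterS (ae_compensated_intB (fg' k) (fg k)) => w h _.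
    by rewrite h.
have bnd k : (0 <= \int[P]_w ((X w - compensated_int N mu D (g k) w) ^+ 2)%:E <=
    2%:E * \int[P]_w ((X w - compensated_int N mu D (g' k) w) ^+ 2)%:E +
    2%:E * (2%:E * \int[mu]_(z in D) ((g' k z - f z) ^+ 2)%:E +
            2%:E * \int[mu]_(z in D) ((g k z - f z) ^+ 2)%:E))%E.
  apply/andP; split; first by apply: integral_ge0 => w _; rewrite lee_fin sqr_ge0.
  apply: le_trans (integral_sqr_triangle P measurableT mX (mc (g' k)) (mc (g k))) _.
  apply: leeD => //; apply: lee_wpmul2l => //; rewrite diff.
  apply: le_trans (integral_sqr_triangle mu mD _ mf _) _ => //.
  apply: leeD => //; apply: lee_wpmul2l => //.
  rewrite le_eqVlt; apply/orP; left; apply/eqP; apply: eq_integral => z _.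
  by congr EFin; ring.
apply: (squeeze_cvge (nearW _ bnd) (cvg_cst 0%E)).
have FF : Filter (\oo : set_system nat) by exact: _.
have c1 := cvgeZl (isT : (2%:E : \bar R) \is a fin_num) g'X.
have c2 := cvgeZl (isT : (2%:E : \bar R) \is a fin_num) g'f.
have c3 := cvgeZl (isT : (2%:E : \bar R) \is a fin_num) gf.
rewrite !mule0 in c1 c2 c3.
have c4 := @cvgeD nat \oo FF R _ _ _ _ (isT : (0 : \bar R) +? 0)%E c2 c3; rewrite adde0 in c4.
have c5 := cvgeZl (isT : (2%:E : \bar R) \is a fin_num) c4; rewrite mule0 in c5.
have c6 := @cvgeD nat \oo FF R _ _ _ _ (isT : (0 : \bar R) +? 0)%E c1 c5; rewrite adde0 in c6.
exact: c6.
Qed.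

End compensated_integral_unique.

(** Provides the finite index list for the jumps. The list may contain vectors that are never
    attained; their levels are empty. *)
Lemma simple_vector_values (R : realType) d' (E : measurableType d') n
    (g : 'I_n -> {sfun E >-> R}) :
  exists s : seq 'rV[R]_n, uniq s /\ forall z, (\row_i g i z) \in s.
Proof.
pose r i : seq R := finmap.enum_fset (fset_set (range (g i))).
have rg i z : g i z \in r i.
  have := in_fset_set (@fimfunP _ _ (g i)) (g i z).
  by rewrite (mem_set (_ : range (g i) (g i z))) => [->|]; last by exists z.
(* A common bound on the numbers of values lets one finite function type enumerate all choices;
   positions past the end of a list read the default 0 and only add spare vectors. *)
pose m := (\max_i size (r i))%N.
pose v (c : {ffun 'I_n -> 'I_m.+1}) : 'rV[R]_n := \row_i nth 0 (r i) (c i).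
exists (undup [seq v c | c <- enum {: {ffun 'I_n -> 'I_m.+1}}]).
split => [|z]; first exact: undup_uniq.
rewrite mem_undup; apply/mapP.
exists [ffun i => inord (index (g i z) (r i))]; first by rewrite mem_enum.
apply/rowP => i; rewrite !mxE ffunE inordK ?nth_index//.
rewrite ltnS (@leq_trans (size (r i)))// ?index_size//.
exact: (leq_bigmax i).
Qed.

Section L1_L2.
Context {R : realType} d (Omega : measurableType d) (P : probability Omega R).

(** Integrates |u| <= u^2 / (2 eta) + eta / 2, which follows from the square of |u| - eta being
    nonnegative. *)
Lemma L1_of_L2 (u : Omega -> R) (eta : R) : measurable_fun setT u -> 0 < eta ->
  (\int[P]_w (u w ^+ 2)%:E <= (eta ^+ 2)%:E)%E ->
  P.-integrable setT (EFin \o u) /\ \int[P]_w `|u w| <= eta.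
Proof.
move=> mu eta0 u2.
have iu2 : P.-integrable setT (EFin \o (fun w => u w ^+ 2)).
  apply/integrableP; split; first by apply/measurable_EFinP; exact: measurable_funX.
  rewrite (eq_integral (fun w => (u w ^+ 2)%:E)) => [|w _]; last first.
    by rewrite abse_EFin ger0_norm// sqr_ge0.
  exact: le_lt_trans u2 (ltry _).
have iu := integrable_sqr_integrable mu iu2; split=> //.
have ie := finite_measure_integrable_cst P (2^-1 * eta) measurableT.
have ic := integrableZl measurableT (2^-1 * eta^-1) iu2.
have iD := integrableD measurableT ic ie.
apply: (@le_trans _ _ (\int[P]_w (2^-1 * eta^-1 * u w ^+ 2 + 2^-1 * eta))).
  apply: le_Rintegral => //; first exact: integrable_norm.
  move=> w _; rewrite -(real_normK (num_real (u w))).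
  have -> : 2^-1 * eta^-1 * `|u w| ^+ 2 + 2^-1 * eta =
      `|u w| + (`|u w| - eta) ^+ 2 / (2 * eta) by field; rewrite gt_eqF.
  by rewrite lerDl divr_ge0 ?sqr_ge0// mulr_ge0// ltW.
rewrite RintegralD// RintegralZl// Rintegral_probability_cst.
have h : \int[P]_w (u w ^+ 2) <= eta ^+ 2.
  by rewrite -lee_fin /Rintegral fineK//; exact: integrable_fin_num.
apply: (@le_trans _ _ (2^-1 * eta^-1 * eta ^+ 2 + 2^-1 * eta)).
  by rewrite lerD2r ler_wpM2l// mulr_ge0// invr_ge0 ltW.
by rewrite le_eqVlt; apply/orP; left; apply/eqP; field; rewrite gt_eqF.
Qed.

Context {n : nat} (h : 'rV[R]_n -> R) (H : R).
Hypotheses (mh : measurable_fun setT h) (hH : forall y, `|h y| <= H)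
  (hL : forall y v, `|h (y + v) - h y| <= H * \sum_i `|v ord0 i|).

(** Turns mean-square errors into errors of expectations: the Lipschitz bound reduces the claim to
    the first moments of the [n] coordinates of [V], each at most [eta]. *)
Lemma lipschitz_expectation (A B V : Omega -> 'rV[R]_n) (eta : R) :
  measurable_fun setT A -> measurable_fun setT B -> measurable_fun setT V ->
  {ae P, forall w, A w = B w + V w} -> 0 < eta ->
  (forall i, (\int[P]_w (V w ord0 i ^+ 2)%:E <= (eta ^+ 2)%:E)%E) ->
  `|\int[P]_w h (A w) - \int[P]_w h (B w)| <= H * (n%:R * eta).
Proof.
move=> mA mB mV AE eta0 V2.
have H0 : 0 <= H by apply: le_trans (normr_ge0 _) (hH 0).
have mVi i : measurable_fun setT (fun w => V w ord0 i).
  exact: (measurableT_comp (@measurable_coord R n i) mV).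
have iV i := (L1_of_L2 (mVi i) eta0 (V2 i)).1.
have mBV := measurable_rVD mB mV.
have ih (Y : Omega -> 'rV[R]_n) (mY : measurable_fun setT Y) :=
  integrable_comp_bounded P mh hH mY.
have -> : \int[P]_w h (A w) = \int[P]_w h (B w + V w).
  rewrite /Rintegral; congr fine; apply: ae_eq_integral => //.
  - by apply/measurable_EFinP; exact: (measurableT_comp mh mA).
  - by apply/measurable_EFinP; exact: (measurableT_comp mh mBV).
  - by apply: filterS AE => w -> _.
rewrite -RintegralB//; [|exact: ih..].
have iB := integrableB measurableT (ih _ mBV) (ih _ mB).
apply: le_trans (le_normr_Rintegral measurableT iB) _.
have iN i := integrable_norm (iV i).
have iS : P.-integrable setT (EFin \o (fun w => \sum_i `|V w ord0 i|)).
  have := @integrable_sum _ _ _ P setT measurableT _ (index_enum 'I_n) xpredT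
    (fun i w => `|V w ord0 i|%:E) (fun i _ => iN i).
  by apply: eq_integrable => // w _; rewrite /= sumEFin.
have iHS := integrableZl measurableT H iS.
apply: (@le_trans _ _ (\int[P]_w (H * \sum_i `|V w ord0 i|))).
  by apply: le_Rintegral => //; exact: integrable_norm.
rewrite RintegralZl// ler_wpM2l//.
have -> : \int[P]_w (\sum_i `|V w ord0 i|) = \sum_i \int[P]_w `|V w ord0 i|.
  rewrite /Rintegral; under eq_integral do rewrite -sumEFin.
  rewrite integral_sum//.
  rewrite (eq_bigr (fun i => (\int[P]_w `|V w ord0 i|)%:E)) => [|i _]; last first.
    by rewrite /Rintegral fineK//; exact: (integrable_fin_num measurableT (iN i)).
  by rewrite sumEFin.
apply: (@le_trans _ _ (\sum_(i < n) eta)).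
  by apply: ler_sum => i _; exact: (L1_of_L2 (mVi i) eta0 (V2 i)).2.
by rewrite sumr_const card_ord mulr_natl.
Qed.

End L1_L2.

(** * Truncation of the stable process *)

Section truncation.
Context {R : realType} (T : R) (n : nat) (s : R) (s_gt0 : 0 < s) (s_lt1 : s < 1).
Context d (Omega : measurableType d) (P : probability Omega R).
Context (N : R.-ker Omega ~> (measurableTypeR R * 'rV[R]_n)%type).
Local Notation mu := (stable_intensity n s_gt0 T).
Local Notation E := (measurableTypeR R * 'rV[R]_n)%type.
Hypothesis pN : poisson_random_measure P N mu.
Context (t eps : R) (tT : 0 <= t <= T) (eps01 : 0 < eps < 1).

Let eps_gt0 : 0 < eps. Proof. by have /andP[] := eps01. Qed.

Let I_ : set (measurableTypeR R) := `]0, t]%classic.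
(** [D1] and [De] carry the compensated parts of [L] and [Leps], [Ds] the removed jumps, and [Db]
    the large jumps common to both. *)
Let D1 : set E := I_ `*` [set y | y != 0 /\ enorm y < 1].
Let De : set E := I_ `*` [set y | eps < enorm y < 1].
Let Ds : set E := I_ `*` small_ball eps.
Let Db : set E := I_ `*` [set y | 1 <= enorm y].

Let mI : measurable I_. Proof. exact: measurable_itv. Qed.

Let mDs : measurable Ds.
Proof. by apply: measurableX => //; exact: measurable_small_ball. Qed.

Let mDe : measurable De.
Proof.
apply: measurableX => //.
have := @measurable_enorm_itv R n `]eps, 1[.
by congr (measurable _); apply/seteqP; split=> y; rewrite /= in_itv.
Qed.

Let mDb : measurable Db.
Proof.
apply: measurableX => //.
have := @measurable_enorm_itv R n `[1, +oo[.
by congr (measurable _); apply/seteqP; split=> y; rewrite /= in_itv/= andbT.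
Qed.

Let D1E : D1 = De `|` Ds.
Proof.
apply/seteqP; split=> [z [zI [z0 z1]]|z [[zI /andP[ez z1]]|[zI [z0 ze]]]].
- have [ze|ze] := leP (enorm z.2) eps; first by right.
  by left; split => //; apply/andP.
- split => //; split => //; apply: contraTneq ez => ->.
  rewrite -leNgt /enorm big1 ?sqrtr0 ?ltW// => i _.
  by rewrite mxE expr0n.
- split => //; split => //; apply: le_lt_trans ze _.
  by have /andP[] := eps01.
Qed.

Let DeDs : De `&` Ds = set0.
Proof.
rewrite -subset0 => z [[_ /andP[ez _]] [_ [_ ze]]].
by rewrite ltNge ze in ez.
Qed.

Let mD1 : measurable D1.
Proof. by rewrite D1E; exact: measurableU. Qed.

Let coord (i : 'I_n) (z : E) : R := z.2 ord0 i.

Let mcoord i : measurable_fun setT (coord i).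
Proof. exact: (measurableT_comp (@measurable_coord R n i) measurable_snd). Qed.

(** The case of exponent 2 and radius 1, admissible because [s < 1] means 2s < 2. *)
Let coord2_lty i : (\int[mu]_(z in D1) (coord i z ^+ 2)%:E < +oo)%E.
Proof.
have s2 : 2 * s < 2 by rewrite gtr_pMr.
have := @integral_small_ball_power R n s s_gt0 T 2 1 t s2 ltr01 tT.
move=> /le_lt_trans/(_ (ltry _)); apply: le_lt_trans.
have mB : measurable (I_ `*` @small_ball R n 1).
  by apply: measurableX => //; exact: measurable_small_ball.
have mf : measurable_fun setT (fun z : E => (enorm z.2 `^ 2)%:E).
  apply/measurable_EFinP; apply: (measurableT_comp (measurable_powR _)).
  exact: (measurableT_comp measurable_enorm measurable_snd).
apply: (@le_trans _ _ (\int[mu]_(z in D1) (enorm z.2 `^ 2)%:E)%E).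
  apply: ge0_le_integral => //.
  - by move=> z _; rewrite lee_fin sqr_ge0.
  - apply: measurable_funTS; apply/measurable_EFinP.
    by apply: measurable_funX; exact: mcoord.
  - exact: measurable_funTS.
  - move=> z _; rewrite lee_fin powR_mulrn ?enorm_ge0//.
    rewrite -(real_normK (num_real (coord i z))) lerXn2r ?nnegrE ?enorm_ge0//.
    exact: coord_le_enorm.
apply: ge0_subset_integral => //.
- exact: measurable_funTS.
- by move=> z _; rewrite lee_fin powR_ge0.
- by move=> z [zI [z0 z1]]; split => //; split => //; exact: ltW.
Qed.

Let coord2_lty_sub i (D : set E) : measurable D -> D `<=` D1 ->
  (\int[mu]_(z in D) (coord i z ^+ 2)%:E < +oo)%E.
Proof.
move=> mD DD1; apply: le_lt_trans (coord2_lty i).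
apply: ge0_subset_integral => //.
  apply: measurable_funTS; apply/measurable_EFinP.
  by apply: measurable_funX; exact: mcoord.
by move=> z _; rewrite lee_fin sqr_ge0.
Qed.

Let DeD1 : De `<=` D1. Proof. by rewrite D1E; exact: subsetUl. Qed.
Let DsD1 : Ds `<=` D1. Proof. by rewrite D1E; exact: subsetUr. Qed.

Section holder_function.
Context (h : 'rV[R]_n -> R) (beta H : R).
Hypotheses (mh : measurable_fun setT h) (hH : forall y, `|h y| <= H)
  (hL : forall y v, `|h (y + v) - h y| <= H * \sum_i `|v ord0 i|)
  (hT : taylor_bound h (n%:R * H) beta) (beta_gt1 : 1 < beta) (beta_lt2 : beta < 2)
  (beta_gt : 2 * s < beta).

Let H_ge0 : 0 <= H. Proof. exact: le_trans (normr_ge0 _) (hH 0). Qed.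

Let beta0 : 0 < beta. Proof. by rewrite (lt_trans ltr01). Qed.

(** The vectors taken by the simple functions are the jump directions, with their level sets in the
    role of the [B j]. By the coordinatewise domination their norms are at most |y|, so the
    telescoped bound is at most the integral of |y|^beta over [Ds]. *)
Lemma simple_small_jumps (g : 'I_n -> {sfun E >-> R})
    (Y : Omega -> 'rV[R]_n) :
  (forall i z, `|g i z| <= `|z.2 ord0 i|) -> adapted N (~` Ds) Y ->
  `|\int[P]_w h (Y w + \row_i compensated_int N mu Ds (g i) w) -
    \int[P]_w h (Y w)| <=
  3 * (n%:R * H) * (t * (power_cst n s beta * eps `^ (beta - 2 * s))).
Proof.
move=> gle aY; have [vs [uvs gvs]] := simple_vector_values g.
set kappa := (fun z => \row_i g i z) in gvs.
have mkappa v : measurable (kappa @^-1` [set v]).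
  rewrite (_ : _ @^-1` _ = \bigcap_i (g i @^-1` [set v ord0 i])).
    by apply: fin_bigcap_measurable => // i _; exact: measurable_sfunP.
  apply/seteqP; split=> [z <- i _|z hz] /=; first by rewrite mxE.
  by apply/rowP => i; rewrite mxE; exact: hz.
have fing i : finite_levels mu Ds (g i).
  by apply: (finite_levels_sqr mDs (mcoord i) (gle i)); exact: coord2_lty_sub.
(* A nonzero vector has a nonzero coordinate, and its level is contained in the level of that
   coordinate's simple function. *)
have finlev v : (mu (level kappa 0%R Ds v) < +oo)%E.
  have [->|v0] := eqVneq v 0; first by rewrite /level eqxx measure0.
  have [i vi] : exists i, v ord0 i != 0.
    apply/existsP; rewrite -negb_forall; apply: contra_neqN v0 => /forallP h0.
    by apply/rowP => i; rewrite mxE; apply/eqP.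
  apply: le_lt_trans (fing i (v ord0 i)); apply: le_measure.
  - exact/mem_set/measurable_level.
  - by apply/mem_set/measurable_level => // x; exact: measurable_sfunP.
  - rewrite /level (negPf v0) (negPf vi) => z [zD /= zv]; split => //=.
    by rewrite -zv mxE.
have mlev := @measurable_level _ _ _ kappa 0 Ds mDs mkappa.
have AE : {ae P, forall w, \row_i compensated_int N mu Ds (g i) w =
    \sum_(v <- vs) compensated N mu (level kappa 0%R Ds v) w *: v}.
  have := ae_compensated_int_level pN mDs uvs gvs mkappa finlev.
  apply: filterS => w hw; apply/rowP => i; rewrite mxE summxE.
  have [_] := hw (fun v => v ord0 i) (mxE _ _ _ _).
  rewrite (_ : _ \o _ = g i); last by apply/funext => z /=; rewrite mxE.
  by move=> ->; apply: eq_bigr => v _; rewrite mxE mulrC.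
have mY := adapted_measurable aY.
have mZ : measurable_fun setT (fun w => \row_i compensated_int N mu Ds (g i) w).
  apply: measurable_fun_coordP => i; under eq_fun do rewrite mxE.
  exact: measurable_compensated_int.
have mS : measurable_fun setT (fun w =>
    \sum_(v <- vs) compensated N mu (level kappa 0%R Ds v) w *: v).
  have aS : adapted N setT (fun w =>
      \sum_(v <- vs) compensated N mu (level kappa 0%R Ds v) w *: v).
    exact: (@adapted_vector_sum _ _ _ _ _ N mu n _ (level kappa 0 Ds) mlev vs setT id).
  exact: (adapted_measurable aS).
have -> : \int[P]_w h (Y w + \row_i compensated_int N mu Ds (g i) w) =
    \int[P]_w h (Y w +
      \sum_(v <- vs) compensated N mu (level kappa 0%R Ds v) w *: v).
  rewrite /Rintegral; congr fine; apply: ae_eq_integral => //.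
  - by apply/measurable_EFinP; apply: (measurableT_comp mh); exact: measurable_rVD.
  - by apply/measurable_EFinP; apply: (measurableT_comp mh); exact: measurable_rVD.
  - by apply: filterS AE => w -> _.
have nH0 : 0 <= n%:R * H by rewrite mulr_ge0.
have b12 : 1 <= beta <= 2 by rewrite !ltW.
apply: le_trans (small_jumps pN mh hH b12 nH0 hT mlev finlev id uvs _ _ aY) _.
- by move=> u v _ _; exact: level_disjoint.
- move=> v _; rewrite -subset0 => z [zl zn]; apply: zn.
  exact: level_sub zl.
rewrite ler_wpM2l ?mulr_ge0//.
(* As [beta] is positive, the zero vector contributes nothing; this licenses the discarded level of
   value 0. *)
have c0 : enorm (0 : 'rV[R]_n) `^ beta = 0.
  rewrite /enorm big1 ?sqrtr0 ?powR0 ?gt_eqF// => i _.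
  by rewrite mxE expr0n.
have [ic <-] := @integrable_level _ _ _ _ kappa 0 Ds vs mDs uvs gvs mkappa mu
  (fun v => enorm v `^ beta) finlev c0.
rewrite -lee_fin /Rintegral fineK; last exact: (integrable_fin_num mDs ic).
apply: le_trans (integral_small_ball_power n s_gt0 beta_gt eps_gt0 tT).
apply: ge0_le_integral => //.
- by move=> z _; rewrite lee_fin powR_ge0.
- exact: (measurable_int mu ic).
- apply/measurable_EFinP; apply: measurable_funTS.
  apply: (measurableT_comp (measurable_powR _)).
  exact: (measurableT_comp measurable_enorm measurable_snd).
- move=> z _; rewrite lee_fin ge0_ler_powR ?nnegrE ?enorm_ge0 ?(ltW beta0)//.
  by apply: le_enorm => i; rewrite mxE; exact: gle.
Qed.

Context (L Le M Me : Omega -> 'rV[R]_n).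
Let J (w : Omega) : 'rV[R]_n := \row_i \int[N w]_(z in Db) z.2 ord0 i.
Hypotheses (mL : measurable_fun setT L) (mLe : measurable_fun setT Le)
  (iM : forall i, compensated_integral P N mu D1 (fun z => z.2 ord0 i)
    (fun w => M w ord0 i))
  (iMe : forall i, compensated_integral P N mu De (fun z => z.2 ord0 i)
    (fun w => Me w ord0 i))
  (LE : {ae P, forall w, L w = M w + J w})
  (LeE : {ae P, forall w, Le w = Me w + J w}).

Lemma truncation_error :
  `|\int[P]_w h (L w) - \int[P]_w h (Le w)| <=
  3 * (n%:R * H) * (t * (power_cst n s beta * eps `^ (beta - 2 * s))).
Proof.
apply/ler_addgt0Pr => e e0.
(* Two approximation errors of size [H * (n%:R * eta)] must together stay below [e]; the summand 1
   keeps the denominator positive. *)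
pose eta := e / (2 * (H * n%:R + 1)).
have den0 : 0 < 2 * (H * n%:R + 1) by rewrite mulr_gt0// ltr_wpDl// mulr_ge0.
have eta0 : 0 < eta by rewrite divr_gt0.
have /choice[G hG] : forall i, exists g : nat -> {sfun E >-> R},
    (forall k z, `|g k z| <= `|coord i z|) /\
    (forall z, g ^~ z @ \oo --> coord i z).
  by move=> i; exact: sfun_approximation.
have Gle i k z : `|G i k z| <= `|z.2 ord0 i| by exact: (hG i).1.
have fG (D : set E) (mD : measurable D) (DD1 : D `<=` D1) i k :
    finite_levels mu D (G i k).
  apply: (finite_levels_sqr mD (mcoord i) ((hG i).1 k)).
  exact: coord2_lty_sub.
have cvgG (D : set E) (mD : measurable D) (DD1 : D `<=` D1) i
    (X : Omega -> R) : compensated_integral P N mu D (coord i) X ->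
    \forall k \near \oo, (\int[P]_w ((X w - compensated_int N mu D (G i k) w) ^+ 2)%:E
      <= (eta ^+ 2)%:E)%E.
  move=> iX.
  have c0 := cvg_sqr_integral mD (mcoord i) (hG i).1 (hG i).2
    (coord2_lty_sub i mD DD1).
  have c1 := compensated_integral_cvg pN mD (mcoord i) iX (fG D mD DD1 i) c0.
  have e2 : (0 < (eta ^+ 2)%:E)%E by rewrite lte_fin exprn_gt0.
  have [N0 _ hN0] := c1 _ (open_ereal_lt' e2).
  by exists N0 => // k kN0; apply: ltW; exact: hN0.
have hk1 : \forall k \near \oo, forall i, i \in enum 'I_n ->
    (\int[P]_w ((M w ord0 i - compensated_int N mu D1 (G i k) w) ^+ 2)%:E
      <= (eta ^+ 2)%:E)%E.
  by apply: filter_seq => i; apply: cvgG => //; exact: iM.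
have hk2 : \forall k \near \oo, forall i, i \in enum 'I_n ->
    (\int[P]_w ((Me w ord0 i - compensated_int N mu De (G i k) w) ^+ 2)%:E
      <= (eta ^+ 2)%:E)%E.
  by apply: filter_seq => i; apply: cvgG => //; exact: iMe.
(* One index for all coordinates and both processes, so that the same simple functions appear on
   [D1], [De] and [Ds]. *)
have [k [{}hk1 {}hk2]] := filter_ex (filterI hk1 hk2).
pose ci (D : set E) w : 'rV[R]_n := \row_i compensated_int N mu D (G i k) w.
have mci (D : set E) : measurable D -> measurable_fun setT (ci D).
  move=> mD; apply: measurable_fun_coordP => i; under eq_fun do rewrite mxE.
  exact: measurable_compensated_int.
(* Large jumps have norm at least 1 > eps, hence lie outside [Ds]. *)
have aJ : adapted N (~` Ds) J.
  apply: measurable_fun_coordP => i; under eq_fun do rewrite mxE.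
  apply: adapted_Rintegral => //; last exact: mcoord.
  move=> z [_ z1] [_ [_ ze]]; have /andP[_] := eps01.
  by rewrite ltNge (le_trans z1 ze).
have aX : adapted N (~` Ds) (fun w => ci De w + J w).
  apply: measurable_rVD => //; apply: measurable_fun_coordP => i.
  under eq_fun do rewrite mxE.
  apply: adapted_compensated_int => //.
  by move=> z ze zs; have : (De `&` Ds) z by []; rewrite DeDs.
have mX := adapted_measurable aX.
have split_int : {ae P, forall w, ci D1 w = ci De w + ci Ds w}.
  have : {ae P, forall w, forall i, i \in enum 'I_n ->
      (N w).-integrable D1 (EFin \o G i k)}.
    by apply: filter_seq => i; exact: (ae_integrable_kernel pN mD1 (fG D1 mD1 _ i k)).
  apply: filterS => w iN; apply/rowP => i; rewrite !mxE /compensated_int.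
  have U (m : {measure set E -> \bar R}) : m.-integrable D1 (EFin \o G i k) ->
      \int[m]_(z in D1) G i k z = \int[m]_(z in De) G i k z + \int[m]_(z in Ds) G i k z.
    move=> im; rewrite D1E Rintegral_setU// -?D1E//.
    by apply/disj_setPS; rewrite DeDs.
  rewrite U ?iN ?mem_enum// U; first by ring.
  exact: (integrable_finite_levels mD1 (fG D1 mD1 _ i k)).
have mM : measurable_fun setT M.
  by apply: measurable_fun_coordP => i; have [] := iM i.
have mMe : measurable_fun setT Me.
  by apply: measurable_fun_coordP => i; have [] := iMe i.
have mB (A B : Omega -> 'rV[R]_n) : measurable_fun setT A ->
    measurable_fun setT B -> measurable_fun setT (fun w => A w - B w).
  move=> mA mB; apply: measurable_fun_coordP => i.
  under eq_fun do rewrite !mxE.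
  by apply: measurable_funB;
    apply: (measurableT_comp (@measurable_coord R n i)).
(* The error vector is [M] minus the simple integral over [D1]: the large jumps [J] cancel, and
   [split_int] rewrites the simple integral as the parts over [De] and [Ds]. *)
have step1 : `|\int[P]_w h (L w) - \int[P]_w h (ci De w + J w + ci Ds w)| <=
    H * (n%:R * eta).
  apply: (lipschitz_expectation mh hH hL mL _ (mB _ _ mM (mci _ mD1)) _ eta0).
  - by apply: measurable_rVD => //; exact: mci.
  - apply: filterS2 LE split_int => w -> ->.
    by apply/rowP => i; rewrite !mxE; ring.
  - move=> i; under eq_integral do rewrite !mxE.
    by apply: hk1; rewrite mem_enum.
have step2 : `|\int[P]_w h (Le w) - \int[P]_w h (ci De w + J w)| <=
    H * (n%:R * eta).
  apply: (lipschitz_expectation mh hH hL mLe mX (mB _ _ mMe (mci _ mDe)) _ eta0).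
  - apply: filterS LeE => w ->.
    by apply/rowP => i; rewrite !mxE; ring.
  - move=> i; under eq_integral do rewrite !mxE.
    by apply: hk2; rewrite mem_enum.
have step3 := simple_small_jumps (fun i => Gle i k) aX.
rewrite -/(ci Ds _) in step3.
have e_eta : H * (n%:R * eta) * 2 <= e.
  have a0 : 0 <= H * n%:R by rewrite mulr_ge0.
  have a1 : 0 < H * n%:R + 1 by rewrite ltr_wpDl.
  rewrite (_ : _ * 2 = e * (H * n%:R / (H * n%:R + 1))); last first.
    by rewrite /eta; field; rewrite gt_eqF.
  rewrite -[leRHS]mulr1 ler_wpM2l ?(ltW e0)// ler_pdivrMr// mul1r.
  by rewrite lerDl.
move: step1 step2 step3; rewrite !ler_norml => /andP[a1 a2] /andP[b1 b2] /andP[c1 c2].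
by apply/andP; split; lra.
Qed.

End holder_function.
End truncation.

Theorem lemma3p1 (R : realType) (T : R) (T_gt0 : 0 < T)
  (n : nat) (n_ge3 : (3 <= n)%N)
  (s : R) (s_gt0 : 0 < s) (s_lt1 : s < 1)
  (d : measure_display) (Omega : measurableType d) (P : probability Omega R)
  (F : R -> set (set Omega)) (usualF : usual_conditions P T F)
  (N : R.-ker Omega ~> (measurableTypeR R * 'rV[R]_n)%type)
  (poissonN : poisson_random_measure P N (stable_intensity n s_gt0 T))
  (L : R -> Omega -> 'rV[R]_n) (stableL : stable_process P N s_gt0 T L)
  (beta : R) (beta_gt : Num.max (2 * s) 1 < beta) (beta_lt2 : beta < 2) :
  exists C1 : R,
  forall (eps : R) (Leps : R -> Omega -> 'rV[R]_n) (h : 'rV[R]_n -> R)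
    (t' t : R),
  0 < eps < 1 ->
  truncated_stable_process P N s_gt0 T eps Leps ->
  holder_space beta h ->
  0 <= t' -> t' <= t -> t <= T ->
  (`| 'E_P[(fun w => h (L (t - t') w) - h (Leps (t - t') w))%R] | <=
   (C1 * eps `^ (beta - 2 * s))%:E * holder_norm beta h * (t - t')%:E)%E.
Proof.
(* The factor 3 comes from the Poisson moments, [n] from the Taylor remainder along the axes, and
   [power_cst] from the sum over dyadic shells. *)
exists (3 * n%:R * power_cst n s beta).
move=> eps Leps h t' t eps01 stableLeps hh t'0 t't tT.
have [beta2s beta1] : 2 * s < beta /\ 1 < beta.
  by move: beta_gt; rewrite gt_max => /andP[].
have n_gt0 : (0 < n)%N by exact: leq_trans n_ge3.
have tau : 0 <= t - t' <= T.
  by rewrite subr_ge0 t't (le_trans _ tT)// gerBl.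
have [mL [M iM LE]] := stableL _ tau.
have [mLe [Me iMe LeE]] := stableLeps _ tau.
set H := fine (holder_norm beta h).
have HE : holder_norm beta h = H%:E.
  by rewrite fineK//; exact: holder_norm_fin_num.
have hH := holder_bounded n_gt0 beta1 beta_lt2 hh.
have hL := holder_lipschitz n_gt0 beta1 beta_lt2 hh.
have mh := measurable_holder n_gt0 beta1 beta_lt2 hh.
have hT := holder_taylor n_gt0 beta1 beta_lt2 hh.
have err := truncation_error s_lt1 poissonN tau eps01 mh hH hL hT beta1 beta_lt2
  beta2s mL mLe iM iMe LE LeE.
have iL := integrable_comp_bounded P mh hH mL.
have iLe := integrable_comp_bounded P mh hH mLe.
have iB := integrableB measurableT iL iLe.
rewrite unlock HE -[X in `|X|%E](fineK (integrable_fin_num measurableT iB)).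
rewrite -[fine _]/(\int[P]_w (h (L (t - t') w) - h (Leps (t - t') w))).
rewrite RintegralB// -!EFinM abse_EFin lee_fin.
apply: le_trans err _; rewrite le_eqVlt; apply/orP; left; apply/eqP.
by rewrite -/H; ring.
Qed.
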